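(* Let $\beta,\sigma,\kappa>0$, $\kappa_c:=2\beta\sigma^2+4\sigma^4$, and suppose $\kappa<\kappa_c$. Consider on $D=\mathbb{R}\times[-1,1]$ the dynamical system $$\dot a=(\beta+2\sigma^2)a+\tfrac12\,\mathrm{sign}(a)a^2-\kappa q,\qquad \dot q=a-(2\sigma^2+|a|)q. \qquad ( * )$$ Then there exists a strictly increasing function $\mathfrak{n}:[-1,1]\to\mathbb{R}$ with $\mathfrak{n}(0)=0$ such that its graph $\{(\mathfrak{n}(q),q):q\in[-1,1]\}$ is the stable manifold of the origin of $( * )$. All discounted Nash equilibria are included in the graph of $\mathfrak{n}$, i.e. every discounted Nash equilibrium $q(\cdot)$ is the second component of a solution $(a(t),q(t))_{t\ge0}$ of $( * )$ lying in the graph of $\mathfrak{n}$ for all $t\ge0$. In particular, for any $q\in[-1,1]$ there exists exactly one discounted Nash equilibrium starting from $q$, and all Nash equilibria converge to the origin as $t\to\infty$.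
   Context: Let $\mathcal{X}=\{0,1\}$. The running cost is $\ell(0,p)=p$, $\ell(1,p)=1-p$ for $p\in[0,1]$. A probability measure on $\mathcal{X}$ is identified with the mass $p$ it gives to $1$, and we set $q=2p-1\in[-1,1]$; a flow $q(\cdot)$ is called a Nash equilibrium if the flow $p(\cdot)=(q(\cdot)+1)/2$ is one, and it starts from $q$ if $q(0)=q$. $\mathcal{A}$ is the set of functions $\alpha:[0,\infty)\times\mathcal{X}\to[0,\infty)$ with $\alpha(\cdot,x)$ locally integrable. For $\alpha\in\mathcal{A}$, $X^{\alpha}$ is the continuous-time Markov chain on $\mathcal{X}$ with jump rate $\sigma^2+\alpha(t,0)$ from $0$ to $1$, jump rate $\sigma^2+\alpha(t,1)$ from $1$ to $0$, and $\mathbb{P}(X^{\alpha}_0=1)=p(0)$. A flow $p:[0,\infty)\to[0,1]$ is a discounted mean-field game Nash equilibrium if there is $\alpha^*\in\mathcal{A}$ minimizing $$J_\beta(\alpha)=\mathbb{E}\int_0^\infty e^{-\beta t}\big(\tfrac12\alpha(t,X^{\alpha}_t)^2+\kappa\ell(X^{\alpha}_t,p(t))\big)dt$$ over $\alpha\in\mathcal{A}$ and such that $p(t)=\mathbb{P}(X^{\alpha^*}_t=1)$ for all $t\ge0$. The stable manifold of a stationary point of $( * )$ is the set of points of $D$ whose forward trajectory converges to that point. *)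

(* Defs.v *)
From HB Require Import structures.
From mathcomp Require Import all_boot all_order all_algebra.
From mathcomp Require Import all_classical all_reals all_analysis.
Set Implicit Arguments.
Unset Strict Implicit.
Unset Printing Implicit Defensive.
Import Order.TTheory GRing.Theory Num.Theory.
Import numFieldNormedType.Exports.
Local Open Scope classical_set_scope.
Local Open Scope ring_scope.

(* The state space {0, 1} is [bool], with [false] for 0 and [true] for 1.
   Functions of time are total on R; only their values on [0, +oo[ matter. *)

Section MarkovChain.
Context (R : realType).
Local Notation mu := (@lebesgue_measure R).

(* The class A; the local integrability on [0, +oo[ is integrability on each
   [0, t] ([locally_integrable] of the library requires an open domain). *)
Definition admissible (alpha : R -> bool -> R) : Prop :=
  forall x : bool,
    (forall t, 0 <= t -> 0 <= alpha t x) /\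
    (forall t, 0 <= t -> mu.-integrable `[0, t] (fun s => (alpha s x)%:E)).

(* [jump_rate sigma alpha t x] is the rate of the jump from x to ~~ x. *)
Definition jump_rate (sigma : R) (alpha : R -> bool -> R) (t : R) (x : bool) : R :=
  sigma ^+ 2 + alpha t x.

(* [K s t x y] is the probability of being in y at time t when in x at time s.
   The rates are only locally integrable in time, so the Kolmogorov forward
   equation is the integrated one; measurability of [K s ^~ x y] makes the
   integral meaningful. *)
Definition transition_function (rate : R -> bool -> R)
    (K : R -> R -> bool -> bool -> R) : Prop :=
  forall (s : R) (x : bool), 0 <= s ->
    [/\ forall y, measurable_fun `[s, +oo[ (fun t => K s t x y),
        forall t y, s <= t -> 0 <= K s t x y,
        forall t, s <= t -> K s t x false + K s t x true = 1
      & forall t y, s <= t ->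
          K s t x y = (x == y)%:R +
            \int[mu]_(u in `[s, t])
               (K s u x (~~ y) * rate u (~~ y) - K s u x y * rate u y)].

Definition cadlag (f : R -> bool) : Prop :=
  forall t, 0 <= t ->
    (f s @[s --> t^'+] --> f t) /\ (0 < t -> cvg (f s @[s --> t^'-])).

Context d (Omega : measurableType d) (P : probability Omega R).

(* Continuous-time Markov chain with jump rates [rate] and P(Y_0 = 1) = m.
   In the Markov property [h] is a finite list of past times and states. *)
Definition markov_chain (rate : R -> bool -> R) (m : R)
    (Y : R -> Omega -> bool) : Prop :=
  [/\ forall t, 0 <= t -> measurable_fun [set: Omega] (Y t),
      forall w, cadlag (fun t => Y t w),
      P [set w | Y 0 w = true] = m%:E
    & exists2 K, transition_function rate K &
        forall (s t : R) (x y : bool) (h : seq (R * bool)),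
          0 <= s <= t -> (forall e, e \in h -> 0 <= e.1 <= s) ->
          let past := [set w | Y s w = x /\
                               (forall e, e \in h -> Y e.1 w = e.2)] in
          P ([set w | Y t w = y] `&` past) = ((K s t x y)%:E * P past)%E].

End MarkovChain.

Section MeanFieldGame.
Context (R : realType).
Local Notation mu := (@lebesgue_measure R).

Definition running_cost (x : bool) (p : R) : R := if x then 1 - p else p.

Context d (Omega : measurableType d) (P : probability Omega R).

(* J_beta(alpha), when the controlled chain X^alpha is [Y]. The integrand is
   nonnegative; the value may be +oo. *)
Definition cost (beta kappa : R) (p : R -> R) (alpha : R -> bool -> R)
    (Y : R -> Omega -> bool) : \bar R :=
  (\int[P]_w \int[mu]_(t in `[0%R, +oo[)
     (expR (- beta * t) *
       (2^-1 * alpha t (Y t w) ^+ 2 + kappa * running_cost (Y t w) (p t)))%:E)%E.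

(* [X m alpha] realizes the chain X^alpha with P(X^alpha_0 = 1) = m, for each
   initial mass m and each control alpha. *)
Definition controlled_chains (sigma : R)
    (X : R -> (R -> bool -> R) -> R -> Omega -> bool) : Prop :=
  forall m alpha, 0 <= m <= 1 -> admissible alpha ->
    markov_chain P (jump_rate sigma alpha) m (X m alpha).

Definition nash_equilibrium (beta kappa : R)
    (X : R -> (R -> bool -> R) -> R -> Omega -> bool) (p : R -> R) : Prop :=
  (forall t, 0 <= t -> 0 <= p t <= 1) /\
  exists alphas : R -> bool -> R,
    [/\ admissible alphas,
        forall alpha, admissible alpha ->
          (cost beta kappa p alphas (X (p 0%R) alphas)
             <= cost beta kappa p alpha (X (p 0%R) alpha))%E
      & forall t, 0 <= t ->
          (p t)%:E = P [set w | X (p 0) alphas t w = true]].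

(* The same notion in the variable q = 2 p - 1. *)
Definition nash_equilibrium_q (beta kappa : R)
    (X : R -> (R -> bool -> R) -> R -> Omega -> bool) (q : R -> R) : Prop :=
  nash_equilibrium beta kappa X (fun t => (q t + 1) / 2).

End MeanFieldGame.

Section DynamicalSystem.
Context (R : realType).

(* Solutions of the system on [0, +oo[ staying in D = R * [-1, 1]. *)
Definition solution (beta sigma kappa : R) (a q : R -> R) : Prop :=
  [/\ forall t : R, 0 <= t -> -1 <= q t <= 1,
      {within `[0, +oo[, continuous a},
      {within `[0, +oo[, continuous q},
      forall t : R, 0 < t ->
        is_derive t (1 : R) a
          ((beta + 2 * sigma ^+ 2) * a t
             + 2^-1 * Num.sg (a t) * a t ^+ 2 - kappa * q t)
    & forall t : R, 0 < t ->
        is_derive t (1 : R) q (a t - (2 * sigma ^+ 2 + `|a t|) * q t)].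

Definition stable_manifold (beta sigma kappa : R) (z : R * R) : set (R * R) :=
  [set z0 | exists a q : R -> R,
     [/\ solution beta sigma kappa a q,
         (a 0, q 0) = z0
       & (a t, q t) @[t --> +oo] --> z]].

End DynamicalSystem.

(* Main.v *)
Require Import Defs.
From HB Require Import structures.
From mathcomp Require Import all_boot all_order all_algebra.
From mathcomp Require Import all_classical all_reals all_analysis.
From mathcomp Require Import measurable_realfun.
From mathcomp Require Import ring lra.
Set Implicit Arguments.
Unset Strict Implicit.
Unset Printing Implicit Defensive.
Import Order.TTheory GRing.Theory Num.Theory.
Import numFieldNormedType.Exports.
Local Open Scope classical_set_scope.
Local Open Scope ring_scope.

(** Put [b = beta + 2 sigma ^ 2] and [D = 2 sigma ^ 2], so that the hypothesis on
    [kappa] reads [kappa < b D].  The first equation of the system is expanding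
    in [a] at rate at least [b]: for a given flow [q] it has exactly one bounded
    solution, which depends on [q] monotonically and with Lipschitz constant
    [kappa / b].  The second equation is damped at rate at least [D].  A pair
    [(a, q)] with bounded [a] is therefore a fixed point of a map whose
    Lipschitz constant is governed by [kappa / (b D) < 1].  This is the source
    of everything that concerns the ordinary differential equation.  The
    contraction argument needs a sign, because the derivative of the second
    drift with respect to [a] is [1 - sg a * q]; the sign comes from the
    symmetry [(a, q) -> (- a, - q)] and from the fact that a bounded solution
    cannot leave [q = 0] ([bounded_solution_zero]), so that a flow starting in
    [[0, 1]] stays there.  One gets existence with exponential decay
    ([pair_exists]) and uniqueness ([bounded_solution_unique]) for every
    initial value in [[-1, 1]].  Hence the bounded solutions are the ones that
    converge to the origin, and [n q0] is the initial costate of the bounded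
    solution starting from [q0].  Time translation shows that bounded solutions
    stay on the graph of [n], and comparison of two backward equations shows
    that [n] is increasing.

    For the game, let [a] be the bounded costate of a flow [q] and [v] the
    bounded solution of the linear equation of the value in state 0; [v] and
    [v - a] solve the Hamilton-Jacobi-Bellman equation of the representative
    player.  Let [m t] be the probability that the controlled chain is in state
    1.  The cost depends on the chain only through [m] ([cost_marginal]), and
    [m] solves the integrated Kolmogorov equation ([marginal_forward]).
    Integrating [exp (- beta t) (v t - m t * a t)] by parts expresses the cost of
    any admissible control as [v 0 - m 0 * a 0] plus the integral of a
    nonnegative [regret] which vanishes for the feedback control
    ([cost_identity]).  So a control is optimal exactly when its regret is zero
    almost everywhere, and such a control moves mass exactly as the feedback
    does ([flux_feedback]).  With the feedback, the Kolmogorov equation is the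
    second equation of the system.  Consequently the Nash equilibria are the
    second components of the bounded solutions ([nash_bounded_solution],
    [bounded_solution_nash]), and the statements on equilibria are those on
    bounded solutions. *)

(** * Differential inequalities on a half line *)

Section Calculus.
Context {R : realType}.
Implicit Types (f g d : R -> R) (s t x df dg : R).

Lemma is_derive_add f g x df dg D : is_derive x (1 : R) f df ->
  is_derive x (1 : R) g dg ->
  df + dg = D -> is_derive x (1 : R) (fun t => f t + g t) D.
Proof. by move=> hf hg <-; exact: is_deriveD. Qed.

Lemma is_derive_sub f g x df dg D : is_derive x (1 : R) f df ->
  is_derive x (1 : R) g dg ->
  df - dg = D -> is_derive x (1 : R) (fun t => f t - g t) D.
Proof. by move=> hf hg <-; exact: is_deriveB. Qed.

Lemma is_derive_opp f x df D : is_derive x (1 : R) f df ->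
  - df = D -> is_derive x (1 : R) (fun t => - f t) D.
Proof. by move=> hf <-; exact: is_deriveN. Qed.

Lemma is_derive_mul f g x df dg D : is_derive x (1 : R) f df ->
  is_derive x (1 : R) g dg ->
  df * g x + f x * dg = D -> is_derive x (1 : R) (fun t => f t * g t) D.
Proof.
move=> hf hg <-.
have := is_deriveM (f := f) (g := g) hf hg.
by rewrite /GRing.scale/= addrC [g x * df]mulrC.
Qed.

Lemma is_derive_scale (l : R) f x df : is_derive x (1 : R) f df ->
  is_derive x (1 : R) (fun t => l * f t) (l * df).
Proof.
move=> hf; apply: (is_derive_mul (is_derive_cst l x 1) hf).
by rewrite mul0r add0r.
Qed.

Lemma is_derive_expM (l : R) x :
  is_derive x (1 : R) (fun t => expR (l * t)) (l * expR (l * x)).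
Proof.
have h : is_derive x (1 : R) (fun t => l * t) l.
  by have := is_derive_scale l (is_derive_id x (1 : R)); rewrite mulr1.
rewrite mulrC; exact: (is_derive1_comp (is_derive_expR _) h).
Qed.

Lemma is_derive_continuous f x df :
  is_derive x (1 : R) f df -> {for x, continuous f}.
Proof. by move=> [h _]; apply/differentiable_continuous/derivable1_diffP. Qed.

Lemma is_derive_sqr_min0 x :
  is_derive x (1 : R) (fun y => Num.min y 0 ^+ 2) (2 * Num.min x 0).
Proof.
case: (ltgtP x 0) => [x0|x0|->].
- apply: (@near_eq_is_derive R R R (fun y : R => y * y : R)).
    near=> y; rewrite min_l ?expr2//; apply/ltW; near: y.
    exact: lt_nbhsl.
  apply: (is_derive_mul (is_derive_id x (1:R)) (is_derive_id x (1:R))).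
  by rewrite mulr1 mul1r mulr_natl.
- apply: (@near_eq_is_derive R R R (cst 0)).
    near=> y; rewrite min_r ?expr0n//; apply/ltW; near: y.
    exact: lt_nbhsr.
  by rewrite mulr0; exact: is_derive_cst.
- apply/is_derive1_caratheodory; exists (fun z => Num.min z 0); split => //.
  + move=> z; rewrite minxx expr0n/= !subr0.
    by case: (leP z 0) => ?; rewrite ?mul0r ?expr2 ?mulr0.
  + by apply: continuous_min; [exact: cvg_id|exact: cvg_cst].
  + by rewrite minxx mulr0.
Unshelve. all: by end_near.
Qed.

Local Notation C0 f := {within `[(0 : R), +oo[%classic, continuous f}.

Lemma within_sub_itv f (a b : R) :
  0 <= a -> C0 f -> {within `[a, b], continuous f}.
Proof.
move=> a0; apply: continuous_subspaceW => z /=; rewrite !in_itv/= => /andP[az _].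
by rewrite andbT (le_trans a0).
Qed.

Lemma nondecreasing_of_deriv f (f' : R -> R) : C0 f ->
  (forall t, 0 < t -> is_derive t (1 : R) f (f' t)) ->
  (forall t, 0 < t -> 0 <= f' t) ->
  forall s t, 0 <= s -> s <= t -> f s <= f t.
Proof.
move=> cf df f0 s t s0; rewrite le_eqVlt => /predU1P[->//|st].
have [||c] := MVT (f := f) (df := f') st.
- by move=> x /[!in_itv]/= /andP[sx _]; apply: df; exact: le_lt_trans sx.
- exact: within_sub_itv.
rewrite in_itv/= => /andP[sc ct] e.
by rewrite -subr_ge0 e mulr_ge0 ?subr_ge0 ?(ltW st)// f0// (le_lt_trans s0).
Qed.

Lemma within_continuous_of_continuous f : continuous f -> C0 f.
Proof. exact: continuous_subspaceT. Qed.

Lemma within_min_sqr d : C0 d -> C0 (fun t => Num.min (d t) 0 ^+ 2).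
Proof.
move=> cd x; apply: (@cvg_comp _ _ _ d (fun y => Num.min y 0 ^+ 2)); first exact: cd.
exact: (is_derive_continuous (is_derive_sqr_min0 _)).
Qed.

Lemma is_derive_min_sqr d t (d' : R) : is_derive t (1 : R) d d' ->
  is_derive t (1 : R) (fun t => Num.min (d t) 0 ^+ 2) (2 * Num.min (d t) 0 * d').
Proof. move=> h; exact: (is_derive1_comp (is_derive_sqr_min0 (d t)) h). Qed.

(** The square of the negative part of [d] is nonincreasing, since it can only
    grow at times when [d] is negative and decreasing. *)
Lemma forward_ge0 d (d' : R -> R) : C0 d ->
  (forall t, 0 < t -> is_derive t (1 : R) d (d' t)) ->
  (forall t, 0 < t -> d t < 0 -> 0 <= d' t) ->
  0 <= d 0 -> forall t, 0 <= t -> 0 <= d t.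
Proof.
move=> cd dd hd d0 t t0.
pose w t := - (Num.min (d t) 0 ^+ 2).
have cw : C0 w by move=> x; apply: cvgN; exact: within_min_sqr.
have := @nondecreasing_of_deriv w (fun t => - (2 * Num.min (d t) 0 * d' t)) cw.
move=> /(_ _ _ 0 t (lexx _) t0); rewrite /w lerN2 (min_r d0) expr0n/=.
move=> h; have {}h : Num.min (d t) 0 ^+ 2 <= 0.
  apply: h => s s0; first by apply: is_derive_opp (erefl _); exact/is_derive_min_sqr/dd.
  case: (leP (d s) 0) => ds; rewrite ?mulr0 ?mul0r ?oppr0//.
  move: ds; rewrite le_eqVlt => /predU1P[->|ds]; first by rewrite mulr0 mul0r oppr0.
  by have := hd _ s0 ds; nra.
move: h; case: (leP (d t) 0) => [|/ltW//] dt h; have := sqr_ge0 (d t) => h2.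
have /eqP : d t ^+ 2 = 0 by apply/le_anti/andP.
by rewrite sqrf_eq0 => /eqP->.
Qed.

(** Evaluating at [t = M / (x * l)] and using [1 + y <= expR y] already contradicts
    [0 < x]. *)
Lemma le0_of_le_exp (x M l : R) : 0 < l ->
  (forall t, 0 <= t -> x <= M * expR (- l * t)) -> x <= 0.
Proof.
move=> l0 h; rewrite leNgt; apply/negP => x0.
have M0 : 0 < M by have := h 0 (lexx _); rewrite mulr0 expR0 mulr1; exact: lt_le_trans.
have t0 : 0 <= M / x / l by rewrite !divr_ge0 ?ltW.
have := h _ t0; rewrite mulNr [l * _]mulrC divfK ?gt_eqF// expRN ler_pdivlMr ?expR_gt0//.
have := expR_ge1Dx (M / x) => h1 h2.
have : x * (1 + M / x) <= M by apply: le_trans h2; rewrite ler_pM2l.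
by rewrite mulrDr mulr1 mulrCA divff ?gt_eqF// mulr1; lra.
Qed.

(** For a function satisfying [d' <= l d] wherever it is negative, a negative
    value would force exponential growth of the negative part, which
    boundedness excludes. *)
Lemma backward_ge0 (l M : R) d (d' : R -> R) : 0 < l -> C0 d ->
  (forall t, 0 < t -> is_derive t (1 : R) d (d' t)) ->
  (forall t, 0 < t -> d t < 0 -> d' t <= l * d t) ->
  (forall t, 0 <= t -> - M <= d t) ->
  forall t, 0 <= t -> 0 <= d t.
Proof.
move=> l0 cd dd hd dM t0 t00.
pose e t := expR (- (2 * l) * t).
pose w t := Num.min (d t) 0 ^+ 2 * e t.
have ce : continuous e by move=> x; exact: is_derive_continuous (is_derive_expM _ x).
have cw : C0 w.
  move=> x; apply: cvgM; first exact: within_min_sqr.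
  exact: within_continuous_of_continuous.
have hw := @nondecreasing_of_deriv w (fun t => 2 * Num.min (d t) 0 * d' t * e t +
   Num.min (d t) 0 ^+ 2 * (- (2 * l) * e t)) cw.
have {}hw : forall s t, 0 <= s -> s <= t -> w s <= w t.
  apply: hw => s s0.
    apply: is_derive_mul (erefl _); first exact/is_derive_min_sqr/dd.
    exact: is_derive_expM.
  have es : 0 < e s by exact: expR_gt0.
  case: (leP (d s) 0) => ds; rewrite ?mulr0 ?mul0r ?expr0n/= ?mul0r ?addr0//.
  rewrite mulrA -mulrDl mulr_ge0 ?(ltW es)//.
  move: ds; rewrite le_eqVlt => /predU1P[->|ds]; first by rewrite !mulr0 !mul0r expr0n/= mul0r addr0.
  by have := hd _ s0 ds; nra.
have : Num.min (d t0) 0 ^+ 2 * e t0 <= 0.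
  apply: (@le0_of_le_exp _ (M ^+ 2) (2 * l)); first by rewrite mulr_gt0.
  move=> t t1; have [tt0|tt0] := leP t0 t.
    apply: (le_trans (hw _ _ t00 tt0)); rewrite ler_wpM2r ?expR_ge0//.
    by have := dM _ t1; case: (leP (d t) 0) => ? ?; nra.
  apply: (@le_trans _ _ (M ^+ 2 * e t0)).
    by rewrite ler_wpM2r ?expR_ge0//; have := dM _ t00; case: (leP (d t0) 0) => ? ?; nra.
  by rewrite ler_wpM2l ?sqr_ge0// ler_expR; nra.
rewrite pmulr_lle0 ?expR_gt0//; case: (leP (d t0) 0) => [|/ltW//] dt h.
have /eqP : d t0 ^+ 2 = 0 by apply/le_anti/andP; split => //; exact: sqr_ge0.
by rewrite sqrf_eq0 => /eqP->.
Qed.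

Lemma decay_cvg0 (l C : R) f : 0 < l ->
  (forall t, 0 <= t -> `|f t| <= C * expR (- l * t)) ->
  f t @[t --> +oo] --> (0 : R).
Proof.
move=> l_gt0 hf.
have C_ge0 : 0 <= C by have := hf 0 (lexx _); rewrite mulr0 expR0 mulr1; exact: le_trans.
apply/cvgrPdist_le => eps eps0.
near=> t.
have t0 : 0 < t by near: t; exact: nbhs_pinfty_gt.
rewrite sub0r normrN (le_trans (hf t (ltW t0)))//.
have rt : 0 < l * t by rewrite mulr_gt0.
rewrite mulNr expRN ler_pdivrMr ?expR_gt0//.
have h1 : l * t <= expR (l * t) by apply: le_trans (expR_ge1Dx _); rewrite lerDr.
apply: (@le_trans _ _ (eps * (l * t))); last by rewrite ler_pM2l.
have : C / eps / l <= t by near: t; apply: nbhs_pinfty_ge; rewrite num_real.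
by rewrite !ler_pdivrMr// [eps * _]mulrC [l * t]mulrC.
Unshelve. all: by end_near.
Qed.

(** The integral starts at [-1] so that the derivative at [0] is two-sided. *)
Lemma antiderivative f : continuous f ->
  exists F : R -> R, forall t, 0 <= t -> is_derive t (1 : R) F (f t).
Proof.
move=> cf; exists (fun x => \int[@lebesgue_measure R]_(t in `[-1, x]) f t) => t t0.
have [|/=||] := @continuous_FTC1_closed R f (-1) t (t + 1) _ _ _ (cf t).
- by rewrite ltrDl.
- apply: continuous_compact_integrable; first exact: segment_compact.
  exact: continuous_subspaceT.
- by lra.
move=> dF Ff; apply: DeriveDef; first exact: dF.
by rewrite -derive1E; exact: Ff.
Qed.

End Calculus.

(** * Linear equations and a fixed point theorem *)

Section LinearEquations.
Context {R : realType}.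
Implicit Types (f g h q a : R -> R) (t x s C : R).
Local Notation C0 f := {within `[(0 : R), +oo[%classic, continuous f}.

(** Freezing [f] at its value at 0 for negative times turns continuity on the half
    line into continuity on the whole line, the form that antiderivatives and
    uniform limits ask for. *)
Lemma continuous_clamp f : C0 f -> continuous (fun t => f (Num.max t 0)).
Proof.
move=> /continuous_within_itvcyP[cf cf0] x.
have cm : {for x, continuous (fun t : R => Num.max t 0)}.
  by apply: continuous_max; [exact: cvg_id|exact: cvg_cst].
have [x0|x0|x0] := ltgtP x 0.
- apply: (@near_cst_continuous _ _ (f 0)).
  near=> y; rewrite max_r//; apply/ltW; near: y; exact: lt_nbhsl.
- apply: continuous_comp => //; rewrite max_l ?ltW//.
  by apply: cf; rewrite in_itv/= x0.
- rewrite x0; apply/left_right_continuousP; split; rewrite /= maxxx.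
    apply: (@cvg_trans _ (f 0 @[t --> 0^'-])); last exact: cvg_cst.
    apply: near_eq_cvg; near=> y; rewrite max_r//.
  apply: (@cvg_trans _ (f t @[t --> 0^'+])); last exact: cf0.
  apply: near_eq_cvg; near=> y; rewrite max_l//.
Unshelve. all: by end_near.
Qed.

Lemma within_of_is_derive f (f' : R -> R) :
  (forall t, 0 <= t -> is_derive t (1 : R) f (f' t)) -> C0 f.
Proof.
move=> df; apply: derivable_within_continuous => t.
by rewrite in_itv/= andbT => /df[].
Qed.

Lemma expNK (l t : R) : expR (l * t) * expR (- l * t) = 1.
Proof. by rewrite -expRD mulNr subrr expR0. Qed.

(** The solution is [exp (l t)] times the tail of the convergent integral of
    [exp (- l s) h s]; the limit of that integral is obtained as a supremum. *)
Lemma backward_linear (l C : R) h : 0 < l -> continuous h ->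
  (forall t, 0 <= t -> `|h t| <= C) ->
  exists a : R -> R,
    (forall t, 0 <= t -> is_derive t (1 : R) a (l * a t - h t)) /\
    (forall t, 0 <= t -> `|a t| <= C / l).
Proof.
move=> l0 ch hC.
pose E t := expR (- l * t).
have cE : continuous E by move=> x; exact: is_derive_continuous (is_derive_expM _ x).
have [H dH] := @antiderivative R (fun t => E t * h t) (fun x => cvgM (cE x) (ch x)).
have dE t : is_derive t (1 : R) E (- l * E t) by exact: is_derive_expM.
pose u t := H t - C / l * E t; pose v t := H t + C / l * E t.
have du t : 0 <= t -> is_derive t (1 : R) u (E t * (h t + C)).
  move=> t0; apply: (is_derive_sub (dH t t0) (is_derive_scale (C / l) (dE t))).
  rewrite mulrA mulrN divfK ?gt_eqF//; ring.
have dv t : 0 <= t -> is_derive t (1 : R) v (E t * (h t - C)).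
  move=> t0; apply: (is_derive_add (dH t t0) (is_derive_scale (C / l) (dE t))).
  rewrite mulrA mulrN divfK ?gt_eqF//; ring.
have cu : C0 u by exact: within_of_is_derive du.
have cv : C0 v by exact: within_of_is_derive dv.
have E0 t : 0 < E t by exact: expR_gt0.
have incu : forall s t, 0 <= s -> s <= t -> u s <= u t.
  apply: (@nondecreasing_of_deriv _ u (fun t => E t * (h t + C)) cu) => t t0; first exact/du/ltW.
  by have := hC _ (ltW t0); rewrite ler_norml => /andP[? ?]; have := E0 t; nra.
have decv : forall s t, 0 <= s -> s <= t -> - v s <= - v t.
  apply: (@nondecreasing_of_deriv _ (fun t => - v t) (fun t => - (E t * (h t - C)))).
  - by move=> x; apply: cvgN; exact: cv.
  - by move=> t t0; exact: is_derive_opp (dv t (ltW t0)) erefl.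
  - move=> t t0.
    by have := hC _ (ltW t0); rewrite ler_norml => /andP[? ?]; have := E0 t; nra.
have Cge0 : 0 <= C by apply: le_trans (hC 0 (lexx _)).
have uv s t : 0 <= s -> 0 <= t -> u s <= v t.
  move=> s0 t0; have [st|/ltW ts] := leP s t.
    apply: (le_trans (incu _ _ s0 st)); rewrite /u /v lerD2l.
    by have := E0 t; have := divr_ge0 Cge0 (ltW l0); nra.
  apply: (@le_trans _ _ (v s)); last by rewrite -lerN2; exact: decv.
  rewrite /u /v lerD2l.
  by have := E0 s; have := divr_ge0 Cge0 (ltW l0); nra.
pose S := [set u s | s in [set s | 0 <= s]].
have supS : has_sup S.
  by split; [exists (u 0); exists 0 => /=|exists (v 0) => _ [s /= s0 <-]; exact: uv].
have ul t : 0 <= t -> u t <= sup S.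
  by move=> t0; apply: ub_le_sup; [case: supS|exists t].
have lv t : 0 <= t -> sup S <= v t.
  by move=> t0; apply: ge_sup; [case: supS|move=> _ [s /= s0 <-]; exact: uv].
exists (fun t => expR (l * t) * (sup S - H t)); split => t t0.
  apply: is_derive_mul (is_derive_expM l t) (is_derive_sub (is_derive_cst (sup S) t 1) (dH t t0) erefl) _.
  by rewrite /cst sub0r mulrN [_ * (E t * _)]mulrA /E expNK mul1r mulrA.
have := ul _ t0; have := lv _ t0; rewrite /u /v => h1 h2.
rewrite ler_norml; have e0 := expR_gt0 (l * t).
have -> : C / l = expR (l * t) * (C / l * E t) by rewrite mulrCA expNK mulr1.
by rewrite -mulrN !ler_pM2l//; apply/andP; split; lra.
Qed.

Lemma forward_linear (n q0 : R) h : continuous h ->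
  exists q : R -> R, q 0 = q0 /\
   forall t, 0 <= t -> is_derive t (1 : R) q (h t - n * q t).
Proof.
move=> ch; pose E t := expR (n * t).
have cE : continuous E by move=> x; exact: is_derive_continuous (is_derive_expM _ x).
have [H dH] := @antiderivative R (fun t => E t * h t) (fun x => cvgM (cE x) (ch x)).
exists (fun t => expR (- n * t) * (H t - (H 0 - q0))); split.
  by rewrite mulr0 expR0 mul1r; lra.
move=> t t0.
apply: is_derive_mul (is_derive_expM (- n) t) (is_derive_sub (dH t t0) (is_derive_cst (H 0 - q0) t 1) erefl) _.
rewrite /cst subr0 [_ * (E t * _)]mulrA [_ * E t]mulrC /E expNK mul1r; ring.
Qed.

(** The constant [K] is the steady state of the equation with source [n * K] and
    damping [n], hence a barrier for the difference of the solutions. *)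
Lemma forward_linear_lip (n K : R) (q1 q2 h1 h2 : R -> R) : 0 < n -> 0 <= K ->
  (forall t, 0 <= t -> is_derive t (1 : R) q1 (h1 t - n * q1 t)) ->
  (forall t, 0 <= t -> is_derive t (1 : R) q2 (h2 t - n * q2 t)) ->
  q1 0 = q2 0 -> (forall t, 0 <= t -> h1 t - h2 t <= n * K) ->
  forall t, 0 <= t -> q1 t - q2 t <= K.
Proof.
move=> n0 K0 d1 d2 e hK t t0; rewrite -subr_ge0.
pose d t := K - (q1 t - q2 t).
have dd (s : R) : 0 <= s -> is_derive s (1 : R) d (- (h1 s - n * q1 s - (h2 s - n * q2 s))).
  move=> s0; apply: is_derive_sub (is_derive_cst K s 1) (is_derive_sub (d1 s s0) (d2 s s0) erefl) _.
  by rewrite sub0r.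
apply: (@forward_ge0 _ d (fun s => - (h1 s - n * q1 s - (h2 s - n * q2 s))) (within_of_is_derive dd)) => //.
  by move=> s s0; exact/dd/ltW.
  by move=> s s0; rewrite /d => ?; have := hK s (ltW s0); nra.
by rewrite /d e subrr subr0.
Qed.

(** The same steady state as in the forward case; the barrier now works backward
    from infinity, which is why both solutions have to be bounded. *)
Lemma backward_linear_lip (l C K : R) (a1 a2 h1 h2 : R -> R) : 0 < l ->
  (forall t, 0 <= t -> is_derive t (1 : R) a1 (l * a1 t - h1 t)) ->
  (forall t, 0 <= t -> is_derive t (1 : R) a2 (l * a2 t - h2 t)) ->
  (forall t, 0 <= t -> `|a1 t| <= C) -> (forall t, 0 <= t -> `|a2 t| <= C) ->
  (forall t, 0 <= t -> h1 t - h2 t <= l * K) ->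
  forall t, 0 <= t -> a1 t - a2 t <= K.
Proof.
move=> l0 d1 d2 b1 b2 hK t t0; rewrite -subr_ge0.
pose d t := K - (a1 t - a2 t).
have dd (s : R) : 0 <= s -> is_derive s (1 : R) d (- (l * a1 s - h1 s - (l * a2 s - h2 s))).
  move=> s0; apply: is_derive_sub (is_derive_cst K s 1) (is_derive_sub (d1 s s0) (d2 s s0) erefl) _.
  by rewrite sub0r.
apply: (@backward_ge0 _ l (- K + C + C) d (fun s => - (l * a1 s - h1 s - (l * a2 s - h2 s))) l0 (within_of_is_derive dd)) => //.
  by move=> s s0; exact/dd/ltW.
  by move=> s s0; rewrite /d => ?; have := hK s (ltW s0); nra.
move=> s s0; have := b1 s s0; have := b2 s s0; rewrite !ler_norml => /andP[? ?] /andP[? ?].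
by rewrite /d; lra.
Qed.

(** Uniform limits inherit continuity and pointwise bounds from the iterates,
    so both are kept as an abstract closed class [S]. *)
Lemma contraction_fixpoint (S : (R -> R) -> Prop) (Phi : (R -> R) -> R -> R)
    (c B : R) (f0 : R -> R) :
  0 <= c -> c < 1 ->
  (forall f, S f -> S (Phi f)) ->
  (forall f g, S f -> S g -> forall t, `|f t - g t| <= B) ->
  (forall f g C, S f -> S g -> (forall t, `|f t - g t| <= C) ->
     forall t, `|Phi f t - Phi g t| <= c * C) ->
  (forall (u : nat -> R -> R) g, (forall n, S (u n)) ->
     (forall n t, `|u n t - g t| <= c ^+ n * B) -> S g) ->
  S f0 -> exists f, S f /\ Phi f =1 f.
Proof.
move=> c0 c1 SPhi SB Phic Scl Sf0.
pose u n := iter n Phi f0.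
have Su n : S (u n) by elim: n => //= n /SPhi.
have B0 : 0 <= B by apply: le_trans (SB _ _ Sf0 Sf0 0).
have uc n m t : `|u n t - u (n + m)%N t| <= c ^+ n * B.
  elim: n m t => [|n IH] m t; first by rewrite expr0 mul1r; exact: SB.
  by rewrite exprS -mulrA; apply: (Phic _ _ _ (Su n) (Su (n + m)%N)).
have cB : (fun n => c ^+ n * B) @ \oo --> (0 : R).
  rewrite -(mul0r B); apply: cvgM; last exact: cvg_cst.
  by apply: cvg_expr; rewrite ger0_norm.
have ucvg t : cvg ((fun n => u n t) @ \oo).
  apply/cauchy_cvgP/cauchy_exP => e e0.
  have /cvgrPdist_lt/(_ e e0)[N _ hN] := cB.
  exists (u N t); exists N => // m /= Nm.
  rewrite /ball_ -(subnKC Nm); apply: (le_lt_trans (uc _ _ _)).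
  have := hN N (leqnn _); rewrite /= sub0r normrN ger0_norm//.
  by rewrite mulr_ge0 ?exprn_ge0.
pose g t := lim ((fun n => u n t) @ \oo).
have ug n t : `|u n t - g t| <= c ^+ n * B.
  have : (fun m => `|u n t - u (n + m)%N t|) @ \oo --> `|u n t - g t|.
    apply: cvg_norm; apply: cvgB; first exact: cvg_cst.
    under eq_fun do rewrite addnC.
    have /= E := cvg_shiftn n (u^~ t) (nbhs (g t)).
    by have := ucvg t; rewrite -/(g t) -E.
  move=> h; rewrite -(cvg_lim _ h)//; apply: limr_le; first by apply/cvg_ex; eexists; exact: h.
  by near=> m; exact: uc.
have Sg : S g by apply: Scl ug.
exists g; split => // t.
apply/eqP; rewrite -subr_eq0 -normr_le0.
have h n : `|Phi g t - g t| <= c ^+ n.+1 * B + c ^+ n.+1 * B.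
  have -> : Phi g t - g t = (Phi g t - u n.+1 t) + (u n.+1 t - g t) by rewrite addrA subrK.
  apply: (le_trans (ler_normD _ _)); apply: lerD; last exact: ug.
  by rewrite exprS -mulrA; apply: (Phic _ _ _ Sg (Su n)) => s; rewrite distrC; exact: ug.
have : (fun n => c ^+ n.+1 * B + c ^+ n.+1 * B) @ \oo --> (0 : R).
  by rewrite -(addr0 (0 : R)); apply: cvgD; rewrite (cvg_shiftS (fun n => c ^+ n * B)).
move=> h0; rewrite -(cvg_lim _ h0)//; apply: limr_ge; first by apply/cvg_ex; eexists; exact: h0.
by near=> n; exact: h.
Unshelve. all: by end_near.
Qed.

Lemma uniform_limit_cont (u : nat -> R -> R) g (c B : R) :
  0 <= c -> c < 1 -> (forall n, continuous (u n)) ->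
  (forall n t, `|u n t - g t| <= c ^+ n * B) -> continuous g.
Proof.
move=> c0 c1 cu ug x; apply/cvgrPdist_lt => e e0.
have cB : (fun n => c ^+ n * B) @ \oo --> (0 : R).
  rewrite -(mul0r B); apply: cvgM; last exact: cvg_cst.
  by apply: cvg_expr; rewrite ger0_norm.
have e3 : 0 < e / 3 by rewrite divr_gt0.
have /cvgrPdist_lt/(_ _ e3)[N _ /(_ N (leqnn _))/=] := cB.
rewrite sub0r normrN => /(le_lt_trans (ler_norm _)) hN.
have /cvgrPdist_lt/(_ _ e3) := cu N x.
apply: filterS => y hy.
have := ug N x; have := ug N y; rewrite distrC.
move: hy; rewrite !ltr_norml !ler_norml => /andP[? ?] /andP[? ?] /andP[? ?].
by apply/andP; split; lra.
Qed.
End LinearEquations.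

(** * Existence of decaying solutions *)

Section Existence.
Context {R : realType}.
Implicit Types (f g h q a : R -> R) (t x y s C M : R).
Local Notation C0 f := {within `[(0 : R), +oo[%classic, continuous f}.

Lemma sgr_sqr x : Num.sg x * x ^+ 2 = x * `|x|.
Proof. by rewrite expr2 mulrA -normrEsg mulrC. Qed.

Lemma sgr_sqr_mono x y : y <= x -> y * `|y| <= x * `|x|.
Proof. by move=> xy; case: (ger0P x) => ?; case: (ger0P y) => ?; nra. Qed.

(** Halved, the bound says that [M x - x |x| / 2] is nondecreasing in [x] on the
    band [|x| <= M]; by [sgr_sqr_mono] it grows at most like [M x]. *)
Lemma sgr_sqr_lip M x y : `|x| <= M -> `|y| <= M -> y <= x ->
  x * `|x| - y * `|y| <= 2 * M * (x - y).
Proof.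
rewrite !ler_norml => /andP[? ?] /andP[? ?] xy.
case: (ger0P x) => ?; case: (ger0P y) => ?.
- have : 0 <= (x - y) * (2 * M - x - y) by apply: mulr_ge0; lra.
  lra.
- have : 0 <= (x - y) * (2 * M - x + y) by apply: mulr_ge0; lra.
  by have : 0 <= x * - y; [apply: mulr_ge0; lra|lra].
- lra.
- have : 0 <= (x - y) * (2 * M + x + y) by apply: mulr_ge0; lra.
  lra.
Qed.

Lemma geometric_limit_bounds (u : nat -> R) x (c B lo hi : R) :
  0 <= c -> c < 1 -> (forall n, lo <= u n <= hi) ->
  (forall n, `|u n - x| <= c ^+ n * B) -> lo <= x <= hi.
Proof.
move=> c0 c1 ub ux.
have cB : (fun n => c ^+ n * B) @ \oo --> (0 : R).
  rewrite -(mul0r B); apply: cvgM; last exact: cvg_cst.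
  by apply: cvg_expr; rewrite ger0_norm.
have h e : 0 < e -> lo <= x + e /\ x <= hi + e.
  move=> e0; have /cvgrPdist_lt/(_ _ e0)[N _ /(_ N (leqnn _))/=] := cB.
  rewrite sub0r normrN => /(le_lt_trans (ler_norm _)) hN.
  by have := ub N; have := ux N; rewrite ler_norml => /andP[? ?] /andP[? ?]; split; lra.
by apply/andP; split; apply/ler_addgt0Pr => e /h[].
Qed.

Variables (b D k : R).
Hypotheses (b0 : 0 < b) (D0 : 0 < D) (k0 : 0 < k).

Definition drift (x : R) := b * x + 2^-1 * Num.sg x * x ^+ 2.

Lemma driftE x : drift x = b * x + 2^-1 * (x * `|x|).
Proof. by rewrite /drift -mulrA sgr_sqr. Qed.

Lemma drift_continuous : continuous drift.
Proof.
rewrite (_ : drift = fun x => b * x + 2^-1 * (x * `|x|)); last by apply/funext => x; exact: driftE.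
move=> x; apply: cvgD; first by apply: cvgM; [exact: cvg_cst|exact: cvg_id].
apply: cvgM; first exact: cvg_cst.
by apply: cvgM; [exact: cvg_id|apply: cvg_norm; exact: cvg_id].
Qed.

Lemma drift_mono x y : y <= x -> b * (x - y) <= drift x - drift y.
Proof. by move=> /sgr_sqr_mono; rewrite !driftE; lra. Qed.

(** The drift has slope at least [b], so a negative value of [A - a] would grow
    exponentially, against the bounds. *)
Lemma adjoint_le M (a A q Q dA : R -> R) : C0 a -> C0 A ->
  (forall t, 0 < t -> is_derive t (1 : R) a (drift (a t) - k * q t)) ->
  (forall t, 0 < t -> is_derive t (1 : R) A (dA t)) ->
  (forall t, 0 < t -> dA t <= drift (A t) - k * Q t) ->
  (forall t, 0 < t -> q t <= Q t) ->
  (forall t, 0 <= t -> a t <= M) -> (forall t, 0 <= t -> - M <= A t) ->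
  forall t, 0 <= t -> a t <= A t.
Proof.
move=> ca cA da dA' hA qQ aM AM t t0; rewrite -subr_ge0.
have cd : C0 (fun t => A t - a t) by move=> x; exact: cvgB (cA x) (ca x).
apply: (@backward_ge0 _ b (2 * M) (fun t => A t - a t)
          (fun t => dA t - (drift (a t) - k * q t)) b0 cd) => //.
- by move=> s s0; exact: is_derive_sub (dA' s s0) (da s s0) erefl.
- move=> s s0 ds; have := hA s s0; have := qQ s s0.
  have := @drift_mono (a s) (A s); rewrite -subr_ge0 => /(_ _) h1 h2 h3.
  have {}h1 := h1 ltac:(lra).
  have : k * q s <= k * Q s by rewrite ler_pM2l.
  lra.
- by move=> s s0; have := aM s s0; have := AM s s0; lra.
Qed.

(** Adding [k / b * K] to a solution gives a supersolution of the equation whose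
    source is larger by [K], because the drift has slope at least [b]. *)
Lemma adjoint_lip M (K : R) (a1 a2 q1 q2 : R -> R) : C0 a1 -> C0 a2 -> 0 <= K ->
  (forall t, 0 < t -> is_derive t (1 : R) a1 (drift (a1 t) - k * q1 t)) ->
  (forall t, 0 < t -> is_derive t (1 : R) a2 (drift (a2 t) - k * q2 t)) ->
  (forall t, 0 <= t -> `|a1 t| <= M) -> (forall t, 0 <= t -> `|a2 t| <= M) ->
  (forall t, 0 <= t -> `|q1 t - q2 t| <= K) ->
  forall t, 0 <= t -> `|a1 t - a2 t| <= k / b * K.
Proof.
move=> c1 c2 K0 d1 d2 b1 b2 hK.
have kK : 0 <= k / b * K by rewrite mulr_ge0// divr_ge0// ltW.
suff gen (a a' q q' : R -> R) : C0 a -> C0 a' ->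
  (forall t, 0 < t -> is_derive t (1 : R) a (drift (a t) - k * q t)) ->
  (forall t, 0 < t -> is_derive t (1 : R) a' (drift (a' t) - k * q' t)) ->
  (forall t, 0 <= t -> `|a t| <= M) -> (forall t, 0 <= t -> `|a' t| <= M) ->
  (forall t, 0 <= t -> `|q t - q' t| <= K) ->
  forall t, 0 <= t -> a t <= a' t + k / b * K.
  move=> t t0; rewrite ler_norml.
  have := gen _ _ _ _ c1 c2 d1 d2 b1 b2 hK t t0.
  have hK' s : 0 <= s -> `|q2 s - q1 s| <= K by rewrite distrC; exact: hK.
  have := gen _ _ _ _ c2 c1 d2 d1 b2 b1 hK' t t0.
  by move=> ? ?; apply/andP; split; lra.
move=> ca ca' da da' ba ba' hq.
have cA : C0 (fun t => a' t + k / b * K).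
  by move=> x; apply: cvgD (ca' x) _; exact: cvg_cst.
apply: (@adjoint_le M a (fun t => a' t + k / b * K) q (fun t => q' t + K)
   (fun t => drift (a' t) - k * q' t) ca cA da).
- by move=> t t0; apply: is_derive_add (da' t t0) (is_derive_cst _ t 1) _; rewrite addr0.
- move=> t t0; have := @drift_mono (a' t + k / b * K) (a' t).
  rewrite lerDl addrAC subrr add0r mulrA [b * _]mulrC divfK ?gt_eqF// => /(_ kK); lra.
- move=> t t0; have := hq t (ltW t0); rewrite ler_norml => /andP[? ?]; lra.
- by move=> t t0; have := ba t t0; rewrite ler_norml => /andP[? ?].
- move=> t t0; have := ba' t t0; rewrite ler_norml => /andP[? ?]; lra.
Qed.

Lemma adjoint_ge0 M a q : C0 a ->
  (forall t, 0 < t -> is_derive t (1 : R) a (drift (a t) - k * q t)) ->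
  (forall t, 0 <= t -> `|a t| <= M) -> (forall t, 0 <= t -> 0 <= q t) ->
  forall t, 0 <= t -> 0 <= a t.
Proof.
move=> ca da ba q0 t t0.
have M0 : 0 <= M by apply: le_trans (ba 0 (lexx _)).
have dr0 : drift 0 = 0 by rewrite driftE mulr0 mul0r mulr0 addr0.
apply: (@adjoint_le M (fun=> 0) a (fun=> 0) q (fun t => drift (a t) - k * q t)) => //.
- exact: within_continuous_of_continuous (fun x => cvg_cst (0 : R)).
- by move=> s s0; apply: is_derive_eq (is_derive_cst 0 s 1) _; rewrite dr0 mulr0 subr0.
- by move=> s s0; exact/q0/ltW.
- by move=> s s0; have := ba s s0; rewrite ler_norml => /andP[].
Qed.

(** Bounded solution of the backward equation for a given flow, as the fixed
    point of the linear problem with rate [l = b + M], where [M = k / b]: on the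
    invariant band [`|a| <= M] the function [M x - x |x| / 2] left in the source
    has slope in [[0, M]], so the contraction constant is [M / l]. *)
Lemma adjoint_exists q : continuous q -> (forall t, 0 <= t -> `|q t| <= 1) ->
  exists a, (forall t, 0 <= t -> is_derive t (1 : R) a (drift (a t) - k * q t)) /\
    (forall t, 0 <= t -> `|a t| <= k / b).
Proof.
move=> cq q1; set M := k / b.
have M0 : 0 < M by rewrite divr_gt0.
pose l := b + M; have l0 : 0 < l by rewrite addr_gt0.
have lM : l * M = k + M * M by rewrite mulrDl [b * M]mulrC divfK ?gt_eqF.
pose h (f : R -> R) t := k * q t + (M * f t - 2^-1 * (f t * `|f t|)).
pose S f := continuous f /\ forall t, `|f t| <= M.
have hex f : exists a, S f ->
    (forall t, 0 <= t -> is_derive t (1 : R) a (l * a t - h f t)) /\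
    (forall t, 0 <= t -> `|a t| <= M).
  have [[cf fM]|nS] := pselect (S f); last by exists f.
  have [|t t0|a [da aM]] := @backward_linear _ l (l * M) (h f) l0.
  - move=> x; apply: cvgD; first by apply: cvgM; [exact: cvg_cst|exact: cq].
    apply: cvgB; first by apply: cvgM; [exact: cvg_cst|exact: cf].
    apply: cvgM; first exact: cvg_cst.
    by apply: cvgM; [exact: cf|apply: cvg_norm; exact: cf].
  - rewrite lM (le_trans (ler_normD _ _))// lerD//.
      by rewrite normrM gtr0_norm// ler_piMr ?(ltW k0)// q1.
    have := fM t; rewrite ler_norml => /andP[? ?].
    by rewrite ler_norml; case: (ger0P (f t)) => ?; apply/andP; split; nra.
  - exists a => _; split => // t t0; rewrite (le_trans (aM _ t0))//.
    by rewrite [l * M]mulrC mulfK// gt_eqF.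
have [A hA] := choice hex.
pose Phi f t := A f (Num.max t 0).
have max0 t : 0 <= Num.max t 0 by rewrite le_max lexx orbT.
have [] := @contraction_fixpoint _ S Phi (M / l) (2 * M) (fun=> 0).
- by rewrite divr_ge0 ?ltW.
- by rewrite ltr_pdivrMr// mul1r ltrDr.
- move=> f Sf; have [dA AM] := hA f Sf; split; last by move=> t; exact: AM.
  by apply: continuous_clamp; exact: within_of_is_derive dA.
- move=> f g [_ fM] [_ gM] t; rewrite (le_trans (ler_normB _ _))//.
  by rewrite mulr_natl mulr2n lerD.
- move=> f g C Sf Sg fgC t; rewrite /Phi.
  have [dA AM] := hA f Sf; have [dB BM] := hA g Sg.
  suff gen (f1 f2 : R -> R) : S f1 -> S f2 -> (forall t, `|f1 t - f2 t| <= C) ->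
      forall t, 0 <= t -> h f1 t - h f2 t <= l * (M / l * C).
    rewrite ler_norml; apply/andP; split.
      rewrite -lerN2 opprK opprB.
      apply: (backward_linear_lip l0 dB dA BM AM) (max0 t).
      by apply: gen => // s; rewrite distrC.
    by apply: (backward_linear_lip l0 dA dB AM BM) (max0 t); exact: gen.
  move=> [_ M1] [_ M2] h12 s s0; rewrite mulrA [l * _]mulrC divfK ?gt_eqF// /h.
  have := h12 s; rewrite ler_norml => /andP[? ?].
  have [f12|/ltW f12] := leP (f1 s) (f2 s).
    have := sgr_sqr_lip (M2 s) (M1 s) f12.
    have : 0 <= M * (C + (f2 s - f1 s)) by apply: mulr_ge0; lra.
    have : 0 <= M * C by apply: mulr_ge0; lra.
    lra.
  have := sgr_sqr_mono f12.
  have : 0 <= M * (C - (f1 s - f2 s)) by apply: mulr_ge0; lra.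
  lra.
- move=> u g Su ug; have c0 : 0 <= M / l by rewrite divr_ge0 ?ltW.
  have c1 : M / l < 1 by rewrite ltr_pdivrMr// mul1r ltrDr.
  split; first exact: uniform_limit_cont c0 c1 (fun n => (Su n).1) ug.
  move=> t; rewrite ler_norml.
  apply: (geometric_limit_bounds c0 c1 _ (ug^~ t)) => n.
  by rewrite -ler_norml; exact: (Su n).2.
- by split; [move=> x; exact: cvg_cst|move=> t; rewrite normr0 ltW].
move=> a [Sa aE]; have [dA AM] := hA a Sa; exists (A a); split => // t t0.
apply: is_derive_eq (dA t t0) _.
have -> : h a t = k * q t + (M * A a t - 2^-1 * (A a t * `|A a t|)).
  by rewrite /h -[a t]aE /Phi (max_l t0).
by rewrite driftE /l; lra.
Qed.

Hypothesis kbD : k < b * D.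
Let e := D - k / b.

Lemma decay_rate_gt0 : 0 < e.
Proof. by rewrite subr_gt0 ltr_pdivrMr// mulrC. Qed.

(** Since the drift dominates [b x] on nonnegative [x], the decreasing function
    [k / b * exp (- e t)] is a supersolution. *)
Lemma adjoint_decay M a q : C0 a ->
  (forall t, 0 < t -> is_derive t (1 : R) a (drift (a t) - k * q t)) ->
  (forall t, 0 <= t -> `|a t| <= M) ->
  (forall t, 0 <= t -> q t <= expR (- e * t)) ->
  forall t, 0 <= t -> a t <= k / b * expR (- e * t).
Proof.
move=> ca da aM hq.
have kb0 : 0 < k / b by rewrite divr_gt0.
have kbE t : 0 <= k / b * expR (- e * t) by apply: mulr_ge0; [exact: ltW|exact: expR_ge0].
have dA t : is_derive t (1 : R) (fun t => k / b * expR (- e * t)) (k / b * (- e * expR (- e * t))).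
  exact: is_derive_scale (is_derive_expM _ _).
apply: (@adjoint_le (Num.max M 0) a (fun t => k / b * expR (- e * t)) q (fun t => expR (- e * t))
  (fun t => k / b * (- e * expR (- e * t)))) => //.
- by apply: within_of_is_derive => t _; exact: dA.
- move=> t t0; rewrite driftE ger0_norm//.
  rewrite (mulrA b) [b * _]mulrC divfK ?gt_eqF// addrAC subrr add0r.
  apply: (@le_trans _ _ 0); last by apply: mulr_ge0; [by []|exact: mulr_ge0].
  by rewrite mulNr mulrN oppr_le0 mulrCA; apply: mulr_ge0; [exact/ltW/decay_rate_gt0|exact: kbE].
- by move=> t t0; exact/hq/ltW.
- by move=> t t0; rewrite le_max (le_trans (ler_norm _) (aM t t0)).
- move=> t t0; apply: (@le_trans _ _ 0); first by rewrite oppr_le0 le_max lexx orbT.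
  exact: kbE.
Qed.

(** The contraction sends a flow [f] to the solution [q] of
    [q' = (1 - f) a + M f - (D + M) q], where [a] is the backward solution for
    [f] and [M = k / b]; a fixed point solves [q' = a - (D + a) q].  As [0 <= f <= 1]
    and [0 <= a <= M], the source has Lipschitz constant [2 M], which gives the
    constant [2 M / (D + M)], smaller than 1 because [k < b D].  The envelope
    [exp (- e t)] is invariant: it bounds [a] by [M exp (- e t)], the source by
    [2 M exp (- e t)], and [D + M - e = 2 M]. *)
Lemma pair_exists (q0 : R) : 0 <= q0 <= 1 -> exists a q,
  [/\ q 0 = q0,
      forall t, 0 <= t -> is_derive t (1 : R) a (drift (a t) - k * q t),
      forall t, 0 <= t -> is_derive t (1 : R) q (a t - (D + `|a t|) * q t),
      forall t, 0 <= t -> 0 <= q t <= expR (- e * t)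
    & forall t, 0 <= t -> 0 <= a t <= k / b * expR (- e * t)].
Proof.
move=> /andP[q00 q01]; set M := k / b; have e0 := decay_rate_gt0.
have M0 : 0 < M by rewrite divr_gt0.
have MD : M < D by rewrite ltr_pdivrMr// mulrC.
pose n := D + M; have n0 : 0 < n by rewrite addr_gt0.
have max0 t : 0 <= Num.max t 0 by rewrite le_max lexx orbT.
have E1 t : 0 <= t -> expR (- e * t) <= 1.
  by move=> t0; rewrite -expR0 ler_expR mulNr oppr_le0 mulr_ge0// ltW.
pose h (f a : R -> R) t := (1 - f t) * a (Num.max t 0) + M * f t.
pose S f := continuous f /\ forall t, 0 <= f t <= expR (- e * Num.max t 0).
have S1 f : S f -> forall t, 0 <= f t <= 1.
  by move=> [_ fE] t; have /andP[-> /le_trans->] := fE t => //; exact: E1.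
have hex f : exists p : (R -> R) * (R -> R), S f ->
    [/\ forall t, 0 <= t -> is_derive t (1 : R) p.1 (drift (p.1 t) - k * f t),
        forall t, 0 <= t -> 0 <= p.1 t <= M * expR (- e * t),
        p.2 0 = q0 & forall t, 0 <= t -> is_derive t (1 : R) p.2 (h f p.1 t - n * p.2 t)].
  have [Sf|nS] := pselect (S f); last by exists (f, f).
  have [cf fE] := Sf.
  have [|a [da aM]] := @adjoint_exists f cf.
    by move=> t t0; have /andP[? ?] := S1 f Sf t; rewrite ger0_norm.
  have ca := within_of_is_derive da.
  have da' t : 0 < t -> is_derive t (1 : R) a (drift (a t) - k * f t).
    by move=> t0; exact/da/ltW.
  have [|q [qq0 dq]] := @forward_linear _ n q0 (h f a).
    move=> x; apply: cvgD; last by apply: cvgM; [exact: cvg_cst|exact: cf].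
    apply: cvgM; first by apply: cvgB; [exact: cvg_cst|exact: cf].
    exact: continuous_clamp.
  exists (a, q) => _; split => // t t0; apply/andP; split.
    by apply: (@adjoint_ge0 M a f ca da' aM) => // s s0; have /andP[] := fE s.
  apply: (@adjoint_decay M a f ca da' aM) => // s s0.
  by have := fE s; rewrite max_l// => /andP[].
have [A hA] := choice hex.
pose Phi f t := (A f).2 (Num.max t 0).
have PhiE f : S f -> forall t, 0 <= t -> 0 <= (A f).2 t <= expR (- e * t).
  move=> Sf; have [da aM qq0 dq] := hA f Sf; have [cf fE] := Sf.
  have cq := within_of_is_derive dq.
  have hb t : 0 < t -> 0 <= h f (A f).1 t <= 2 * M * expR (- e * t).
    move=> t0; rewrite /h max_l ?(ltW t0)//.
    have := fE t; rewrite max_l ?(ltW t0)// => /andP[? ?].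
    have /andP[? ?] := S1 f Sf t; have /andP[? ?] := aM t (ltW t0).
    have : 0 <= (1 - f t) * (A f).1 t by apply: mulr_ge0; lra.
    have : 0 <= f t * (A f).1 t by apply: mulr_ge0; lra.
    have : M * f t <= M * expR (- e * t) by rewrite ler_pM2l.
    have : 0 <= M * f t by apply: mulr_ge0; [exact: ltW|].
    by move=> ? ? ? ?; apply/andP; split; lra.
  move=> t t0; apply/andP; split.
    apply: (@forward_ge0 _ _ (fun t => h f (A f).1 t - n * (A f).2 t) cq) => //.
    - by move=> s s0; exact/dq/ltW.
    - by move=> s s0 ?; have /andP[? ?] := hb s s0; nra.
    - by rewrite qq0.
  rewrite -subr_ge0.
  have dd s : 0 <= s -> is_derive s (1 : R) (fun s => expR (- e * s) - (A f).2 s)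
     (- e * expR (- e * s) - (h f (A f).1 s - n * (A f).2 s)).
    by move=> s0; exact: is_derive_sub (is_derive_expM _ _) (dq s s0) erefl.
  apply: (@forward_ge0 _ _ (fun s => - e * expR (- e * s) - (h f (A f).1 s - n * (A f).2 s))
     (within_of_is_derive dd) _ _ _ t t0).
  - by move=> s s0; exact: dd _ (ltW s0).
  - move=> s s0 hs; have /andP[? ?] := hb s s0.
    have : n * expR (- e * s) <= n * (A f).2 s by rewrite ler_pM2l//; lra.
    by rewrite /n /e -/M; lra.
  - by rewrite qq0 mulr0 expR0 subr_ge0.
have c0 : 0 <= 2 * M / n.
  by apply: divr_ge0; [apply: mulr_ge0; [by []|exact: ltW]|exact: ltW].
have c1 : 2 * M / n < 1 by rewrite ltr_pdivrMr// mul1r /n; lra.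
have [] := @contraction_fixpoint _ S Phi (2 * M / n) 1 (fun=> 0) c0 c1.
- move=> f Sf; split; last by move=> t; exact: PhiE.
  by apply: continuous_clamp; have [_ _ _ /within_of_is_derive] := hA f Sf.
- move=> f g Sf Sg t; have /andP[? ?] := S1 f Sf t; have /andP[? ?] := S1 g Sg t.
  by rewrite ler_norml; apply/andP; split; lra.
- suff gen f g C : S f -> S g -> (forall t, `|f t - g t| <= C) ->
      forall t, Phi f t - Phi g t <= 2 * M / n * C.
    move=> f g C Sf Sg fgC t; rewrite ler_norml; apply/andP; split; last exact: gen.
    by rewrite -lerN2 opprK opprB; apply: gen => // s; rewrite distrC.
  move=> Sf Sg fgC t; have [da aM qq0 dq] := hA f Sf; have [da' aM' qq0' dq'] := hA g Sg.
  have C_ge0 : 0 <= C by apply: le_trans (fgC 0).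
  have aM1 t' : 0 <= t' -> `|(A f).1 t'| <= M.
    move=> s0; have /andP[? h2] := aM _ s0; rewrite ger0_norm// (le_trans h2)//.
    by rewrite ler_piMr ?(ltW M0)// E1.
  have aM2 t' : 0 <= t' -> `|(A g).1 t'| <= M.
    move=> s0; have /andP[? h2] := aM' _ s0; rewrite ger0_norm// (le_trans h2)//.
    by rewrite ler_piMr ?(ltW M0)// E1.
  have aa := @adjoint_lip M C _ _ f g (within_of_is_derive da) (within_of_is_derive da') C_ge0
     (fun u hu => da u (ltW hu)) (fun u hu => da' u (ltW hu)) aM1 aM2 (fun t _ => fgC t).
  apply: (forward_linear_lip n0 _ dq dq' _ _ (max0 t)).
  + exact: mulr_ge0.
  + by rewrite qq0 qq0'.
  move=> s s0; rewrite mulrA [n * _]mulrC divfK ?gt_eqF// /h (max_l s0).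
  have := aa s s0; have := fgC s; have /andP[? ?] := S1 f Sf s.
  have := aM2 s s0; rewrite !ler_norml -/M => /andP[? ?] /andP[? ?] /andP[? ?].
  have /andP[? _] := aM' s s0.
  have MC : 0 <= M * C by apply: mulr_ge0; [exact: ltW|].
  have : (1 - f s) * ((A f).1 s - (A g).1 s) <= M * C.
    have : 0 <= (1 - f s) * (M * C - ((A f).1 s - (A g).1 s)) by apply: mulr_ge0; lra.
    by have : 0 <= f s * (M * C); [apply: mulr_ge0; lra|lra].
  have : (M - (A g).1 s) * (f s - g s) <= M * C.
    have : 0 <= (M - (A g).1 s) * (C - (f s - g s)) by apply: mulr_ge0; lra.
    by have : 0 <= (A g).1 s * C; [apply: mulr_ge0; lra|lra].
  lra.
- move=> u g Su ug.
  split; first exact: uniform_limit_cont c0 c1 (fun n => (Su n).1) ug.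
  by move=> t; apply: (geometric_limit_bounds c0 c1 _ (ug^~ t)) => m; exact: (Su m).2.
- by split; [move=> x; exact: cvg_cst|move=> t; rewrite lexx expR_ge0].
move=> f [Sf fE]; have [da aM qq0 dq] := hA f Sf.
have fq t : 0 <= t -> f t = (A f).2 t by move=> t0; rewrite -[in LHS]fE /Phi max_l.
exists (A f).1, (A f).2; split => // t t0.
- by rewrite -fq//; exact: da.
- apply: is_derive_eq (dq t t0) _.
  rewrite /h max_l// fq// ger0_norm; last by have /andP[] := aM t t0.
  by rewrite /n; lra.
- exact: PhiE.
Qed.
End Existence.

(** * Bounded solutions and the stable manifold *)

Section BoundedSolutions.
Context {R : realType}.
Variables (beta sigma kappa : R).
Hypotheses (beta_gt0 : 0 < beta) (sigma_gt0 : 0 < sigma) (kappa_gt0 : 0 < kappa).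
Hypothesis kappa_lt : kappa < 2 * beta * sigma ^+ 2 + 4 * sigma ^+ 4.
Implicit Types (a q : R -> R) (t x y s M : R).
Local Notation C0 f := {within `[(0 : R), +oo[%classic, continuous f}.
Let b := beta + 2 * sigma ^+ 2.
Let D := 2 * sigma ^+ 2.
Let rate := D - kappa / b.

Lemma b_gt0 : 0 < b.
Proof. by rewrite addr_gt0// mulr_gt0// exprn_gt0. Qed.

Lemma D_gt0 : 0 < D.
Proof. by rewrite mulr_gt0// exprn_gt0. Qed.

Lemma kappa_lt_bD : kappa < b * D.
Proof.
apply: (lt_le_trans kappa_lt); rewrite /b /D (_ : 4%N = (2 * 2)%N)// exprM; lra.
Qed.

(** By the dichotomy at infinity of the backward equation, boundedness of the
    costate singles out the stable manifold. *)
Definition bounded_solution a q :=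
  solution beta sigma kappa a q /\ exists M, forall t, 0 <= t -> `|a t| <= M.

Lemma bounded_solutionN a q :
  bounded_solution a q -> bounded_solution (fun t => - a t) (fun t => - q t).
Proof.
move=> [[q1 ca cq da dq] [M aM]]; split; last first.
  by exists M => t t0; rewrite normrN; exact: aM.
split.
- by move=> t t0; rewrite lerN2 lerNl andbC; exact: q1.
- by move=> x; apply: cvgN; exact: ca.
- by move=> x; apply: cvgN; exact: cq.
- move=> t t0; apply: is_derive_opp (da t t0) _.
  by rewrite sgrN sqrrN; lra.
- move=> t t0; apply: is_derive_opp (dq t t0) _.
  by rewrite normrN; lra.
Qed.

Lemma within_shift (f : R -> R) (t0 : R) : 0 <= t0 -> C0 f -> C0 (fun t => f (t + t0)).
Proof.
move=> t00 /continuous_clamp cf.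
have : continuous (fun t => f (Num.max (t + t0) 0)).
  move=> x; apply: (@cvg_comp _ _ _ (fun t => t + t0) (fun y => f (Num.max y 0))); last exact: cf.
  by apply: cvgD; [exact: cvg_id|exact: cvg_cst].
move=> /(@within_continuous_of_continuous R); apply: subspace_eq_continuous => x.
by rewrite inE/= in_itv/= andbT => x0; rewrite /from_subspace/= max_l// addr_ge0.
Qed.

Lemma bounded_solution_shift (t0 : R) a q : 0 <= t0 ->
  bounded_solution a q -> bounded_solution (fun t => a (t + t0)) (fun t => q (t + t0)).
Proof.
move=> t00 [[q1 ca cq da dq] [M aM]]; split; last first.
  by exists M => t tge0; apply: aM; rewrite addr_ge0.
have ds t : is_derive t (1 : R) (fun t => t + t0) 1.
  by apply: is_derive_add (is_derive_id t (1 : R)) (is_derive_cst t0 t 1) _; rewrite addr0.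
split.
- by move=> t tge0; apply: q1; rewrite addr_ge0.
- exact: within_shift.
- exact: within_shift.
- move=> t tgt0; have tt0 : 0 < t + t0 by rewrite ltr_wpDr.
  have := @is_derive1_comp R a (fun t => t + t0) t _ _ (da _ tt0) (ds t); rewrite mulr1; exact.
- move=> t tgt0; have tt0 : 0 < t + t0 by rewrite ltr_wpDr.
  have := @is_derive1_comp R q (fun t => t + t0) t _ _ (dq _ tt0) (ds t); rewrite mulr1; exact.
Qed.

(** Comparison with the zero solution: since [|q| <= 1], the drift of [|q|] is at
    most [|a| (1 - |q|) - D |q|], while [|a| <= kappa / b * Q].  Iterating this
    improvement of the bound forces [q] to vanish. *)
Lemma bounded_solution_shrink a q (Q : R) : bounded_solution a q -> q 0 = 0 -> 0 <= Q ->
  (forall t, 0 <= t -> `|q t| <= Q) ->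
  forall t, 0 <= t -> `|q t| <= kappa / (b * D) * Q.
Proof.
move=> sol q00 Q0 qQ; have bg := b_gt0; have Dg := D_gt0.
suff gen a' q' : bounded_solution a' q' -> q' 0 = 0 -> (forall t, 0 <= t -> `|q' t| <= Q) ->
    forall t, 0 <= t -> q' t <= kappa / (b * D) * Q.
  move=> t t0; rewrite ler_norml; apply/andP; split; last exact: gen sol q00 qQ t t0.
  rewrite lerNl; apply: gen (bounded_solutionN sol) _ _ t t0; first by rewrite q00 oppr0.
  by move=> s s0; rewrite normrN; exact: qQ.
move=> [[q1 ca cq da dq] [M aM]] q'0 q'Q t t0.
have dr0 : drift b 0 = 0 by rewrite driftE mulr0 mul0r mulr0 addr0.
have aQ : forall t, 0 <= t -> `|a' t - 0| <= kappa / b * Q.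
  apply: (@adjoint_lip R b kappa bg kappa_gt0 M Q a' (fun=> 0) q' (fun=> 0)) => //.
  - exact: within_continuous_of_continuous (fun x => cvg_cst (0 : R)).
  - by move=> s s0; apply: is_derive_eq (is_derive_cst 0 s 1) _; rewrite dr0 mulr0 subr0.
  - by move=> s s0; rewrite normr0; apply: le_trans (aM 0 (lexx _)).
  - by move=> s s0; rewrite subr0; exact: q'Q.
set K := kappa / (b * D) * Q.
have KE : D * K = kappa / b * Q.
  by rewrite /K; field; rewrite !gt_eqF.
have K0 : 0 <= K by rewrite mulr_ge0// divr_ge0 ?mulr_ge0 ?ltW.
rewrite -subr_ge0.
apply: (@forward_ge0 R (fun t => K - q' t)
   (fun t => - (a' t - (D + `|a' t|) * q' t)) _ _ _ _ t t0).
- by move=> x; apply: cvgB (cq x); exact: cvg_cst.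
- by move=> s s0; apply: is_derive_sub (is_derive_cst K s 1) (dq s s0) _; rewrite sub0r.
- move=> s s0 hs; have := aQ s (ltW s0); rewrite subr0 -KE => aK.
  have := q1 s (ltW s0) => /andP[_ ?].
  have := ler_norm (a' s) => ?.
  have : 0 <= D * (q' s - K) by apply: mulr_ge0; lra.
  have : 0 <= q' s * `|a' s| by apply: mulr_ge0; [lra|].
  lra.
- by rewrite q'0 subr0.
Qed.

Lemma bounded_solution_zero a q : bounded_solution a q -> q 0 = 0 ->
  forall t, 0 <= t -> q t = 0.
Proof.
move=> sol q00 t t0; have bD : 0 < b * D by rewrite mulr_gt0 ?b_gt0 ?D_gt0.
set c := kappa / (b * D).
have c0 : 0 <= c by rewrite divr_ge0 ?(ltW kappa_gt0) ?(ltW bD).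
have c1 : c < 1 by rewrite ltr_pdivrMr// mul1r kappa_lt_bD.
have h n : forall t, 0 <= t -> `|q t| <= c ^+ n * 1.
  elim: n => [|n IH].
    by move=> s s0; rewrite expr0 mulr1 ler_norml; have [[q1 _ _ _ _] _] := sol; exact: q1.
  by rewrite exprS -mulrA; apply: (bounded_solution_shrink sol q00 _ IH); apply: mulr_ge0 => //; exact: exprn_ge0.
have /andP[? ?] : 0 <= q t <= 0.
  apply: (@geometric_limit_bounds R (fun=> 0) (q t) c 1 0 0) => //; first by move=> _; rewrite lexx.
  by move=> n; rewrite sub0r normrN; exact: h.
by lra.
Qed.

Lemma bounded_solution_ivt a1 q1 a2 q2 (t : R) :
  bounded_solution a1 q1 -> bounded_solution a2 q2 -> 0 <= t ->
  q1 0 <= q2 0 -> q2 t <= q1 t -> exists2 s, 0 <= s <= t & q1 s = q2 s.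
Proof.
move=> [[_ _ c1 _ _] _] [[_ _ c2 _ _] _] t0 h0 ht.
have cd : C0 (fun t => q2 t - q1 t) by move=> x; exact: cvgB (c2 x) (c1 x).
have [|s] := @IVT R (fun t => q2 t - q1 t) 0 t 0 t0 (within_sub_itv (lexx _) cd).
  by rewrite ge_min le_max !subr_le0 ht !subr_ge0 h0 orbT.
rewrite in_itv/= => st /eqP; rewrite subr_eq0 => /eqP e; by exists s.
Qed.

Lemma zero_bounded_solution : bounded_solution (fun=> 0) (fun=> 0).
Proof.
split; last by exists 0 => t _; rewrite normr0.
have c : C0 (fun=> 0 : R) by exact: within_continuous_of_continuous (fun x => cvg_cst (0 : R)).
split => // t _; first by rewrite lerN10 ler01.
- by apply: is_derive_eq (is_derive_cst 0 t 1) _; rewrite expr2 !mulr0; lra.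
- by apply: is_derive_eq (is_derive_cst 0 t 1) _; rewrite mulr0 subr0.
Qed.

(** To become negative the flow would have to cross 0, and from there on it is
    the zero flow. *)
Lemma bounded_solution_ge0 a q : bounded_solution a q -> 0 <= q 0 ->
  forall t, 0 <= t -> 0 <= q t.
Proof.
move=> sol q0 t t0; rewrite leNgt; apply/negP => qt.
have [s /andP[s0 st] /= qs] := bounded_solution_ivt zero_bounded_solution sol t0 q0 (ltW qt).
have := bounded_solution_zero (bounded_solution_shift s0 sol).
rewrite add0r => /(_ (esym qs) (t - s)); rewrite subrK subr_ge0 => /(_ st) e.
by rewrite e ltxx in qt.
Qed.

Lemma bounded_solution_costate_ge0 a q : bounded_solution a q -> 0 <= q 0 ->
  forall t, 0 <= t -> 0 <= a t.
Proof.
move=> sol q0; have [[_ ca _ da _] [M aM]] := sol.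
exact: (@adjoint_ge0 R b kappa b_gt0 kappa_gt0 M a q ca da aM (bounded_solution_ge0 sol q0)).
Qed.

(** For nonnegative flows and costates the difference of the two forward drifts is
    [(1 - q1) (a1 - a2) - (D + a2) (q1 - q2)], so a bound [Q] on [|q1 - q2|] improves
    to [kappa / (b D) * Q]. *)
Lemma bounded_solution_unique_ge0 a1 q1 a2 q2 :
  bounded_solution a1 q1 -> bounded_solution a2 q2 -> q1 0 = q2 0 -> 0 <= q1 0 ->
  forall t, 0 <= t -> q1 t = q2 t.
Proof.
move=> s1 s2 e q0 t t0; have bg := b_gt0; have Dg := D_gt0.
have bD : 0 < b * D by rewrite mulr_gt0.
set c := kappa / (b * D).
have c0 : 0 <= c by rewrite divr_ge0 ?(ltW kappa_gt0) ?(ltW bD).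
have c1 : c < 1 by rewrite ltr_pdivrMr// mul1r kappa_lt_bD.
suff gen a1' q1' a2' q2' (Q : R) : bounded_solution a1' q1' -> bounded_solution a2' q2' ->
   q1' 0 = q2' 0 -> 0 <= q1' 0 -> 0 <= Q -> (forall t, 0 <= t -> `|q1' t - q2' t| <= Q) ->
   forall t, 0 <= t -> q1' t - q2' t <= c * Q.
  have h n : forall t, 0 <= t -> `|q1 t - q2 t| <= c ^+ n * 1.
    elim: n => [|n IH] s ss.
      have [[q1b _ _ _ _] _] := s1; have [[q2b _ _ _ _] _] := s2.
      have /andP[? ?] := q1b s ss; have /andP[? ?] := q2b s ss.
      have := bounded_solution_ge0 s1 q0 ss; have := bounded_solution_ge0 s2.
      rewrite -e => /(_ q0 s ss) ? ?.
      by rewrite expr0 mulr1 ler_norml; apply/andP; split; lra.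
    have cn : 0 <= c ^+ n * 1 by rewrite mulr1 exprn_ge0.
    rewrite exprS -mulrA ler_norml; apply/andP; split; last exact: gen s1 s2 e q0 cn IH s ss.
    rewrite lerNl opprB; apply: (gen _ _ _ _ _ s2 s1) => //; first by rewrite -e.
    by move=> u uu; rewrite distrC; exact: IH.
  have /andP[? ?] : 0 <= q1 t - q2 t <= 0.
    apply: (@geometric_limit_bounds R (fun=> 0) (q1 t - q2 t) c 1 0 0) => //.
      by move=> _; rewrite lexx.
    by move=> n; rewrite sub0r normrN; exact: h.
  by lra.
move=> {s1 s2 e q0 t t0} s1 s2 e q0 Q0 hQ t t0.
have [[b1 ca1 cq1 da1 dq1] [M1 aM1]] := s1; have [[b2 ca2 cq2 da2 dq2] [M2 aM2]] := s2.
have aa : forall t, 0 <= t -> `|a1' t - a2' t| <= kappa / b * Q.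
  apply: (@adjoint_lip R b kappa bg kappa_gt0 (Num.max M1 M2) Q a1' a2' q1' q2') => //.
    by move=> s ss; rewrite le_max aM1.
  by move=> s ss; rewrite le_max aM2// orbT.
have KE : D * (c * Q) = kappa / b * Q by rewrite /c; field; rewrite !gt_eqF.
rewrite -subr_ge0.
apply: (@forward_ge0 R (fun t => c * Q - (q1' t - q2' t))
   (fun t => - (a1' t - (D + `|a1' t|) * q1' t - (a2' t - (D + `|a2' t|) * q2' t))) _ _ _ _ t t0).
- by move=> x; apply: cvgB; [exact: cvg_cst|exact: cvgB (cq1 x) (cq2 x)].
- move=> s ss; apply: is_derive_sub (is_derive_cst (c * Q) s 1)
    (is_derive_sub (dq1 s ss) (dq2 s ss) erefl) _.
  by rewrite sub0r.
- move=> s ss hs; have ss' := ltW ss.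
  rewrite (ger0_norm (bounded_solution_costate_ge0 s1 q0 ss')).
  have q20 : 0 <= q2' 0 by rewrite -e.
  rewrite (ger0_norm (bounded_solution_costate_ge0 s2 q20 ss')).
  have a20 := bounded_solution_costate_ge0 s2 q20 ss'.
  have q1s := bounded_solution_ge0 s1 q0 ss'.
  have := aa s ss'; rewrite -KE ler_norml => /andP[? ?].
  have /andP[_ ?] := b1 s ss'.
  have cQ : 0 <= c * Q by rewrite mulr_ge0.
  have DcQ : 0 <= D * (c * Q) by apply: mulr_ge0; [exact: ltW|].
  have : 0 <= D * ((q1' s - q2' s) - c * Q) by apply: mulr_ge0; [exact: ltW|lra].
  have : 0 <= a2' s * (q1' s - q2' s) by apply: mulr_ge0; [by []|lra].
  have : 0 <= (1 - q1' s) * (D * (c * Q) - (a1' s - a2' s)) by apply: mulr_ge0; lra.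
  have : 0 <= q1' s * (D * (c * Q)) by apply: mulr_ge0.
  lra.
- by rewrite e subrr subr0 mulr_ge0.
Qed.

Lemma bounded_solution_unique a1 q1 a2 q2 :
  bounded_solution a1 q1 -> bounded_solution a2 q2 -> q1 0 = q2 0 ->
  forall t, 0 <= t -> q1 t = q2 t.
Proof.
move=> s1 s2 e t t0; have [q0|/ltW q0] := leP 0 (q1 0).
  exact: bounded_solution_unique_ge0 s1 s2 e q0 t t0.
apply: oppr_inj.
apply: (bounded_solution_unique_ge0 (bounded_solutionN s1) (bounded_solutionN s2)) => //.
  by rewrite e.
by rewrite oppr_ge0.
Qed.

Lemma bounded_solution_costate_unique a1 q1 a2 q2 :
  bounded_solution a1 q1 -> bounded_solution a2 q2 -> q1 0 = q2 0 ->
  forall t, 0 <= t -> a1 t = a2 t.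
Proof.
move=> s1 s2 e t t0; have qq := bounded_solution_unique s1 s2 e.
have [[_ ca1 _ da1 _] [M1 aM1]] := s1; have [[_ ca2 _ da2 _] [M2 aM2]] := s2.
apply/eqP; rewrite -subr_eq0 -normr_le0 -[leRHS](mulr0 (kappa / b)).
apply: (@adjoint_lip R b kappa b_gt0 kappa_gt0 (Num.max M1 M2) 0 a1 a2 q1 q2) => //.
- by move=> s ss; rewrite le_max aM1.
- by move=> s ss; rewrite le_max aM2// orbT.
- by move=> s ss; rewrite qq// subrr normr0.
Qed.

Lemma bounded_solution_order a1 q1 a2 q2 :
  bounded_solution a1 q1 -> bounded_solution a2 q2 -> q1 0 <= q2 0 ->
  forall t, 0 <= t -> q1 t <= q2 t.
Proof.
move=> s1 s2 e t t0; rewrite leNgt; apply/negP => qt.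
have [s /andP[s0 st] qs] := bounded_solution_ivt s1 s2 t0 e (ltW qt).
have := bounded_solution_unique (bounded_solution_shift s0 s1) (bounded_solution_shift s0 s2).
rewrite add0r => /(_ qs (t - s)); rewrite subrK subr_ge0 => /(_ st) e'.
by rewrite e' ltxx in qt.
Qed.

(** The costates are ordered like the flows; were they equal at time 0, their
    difference would start with the negative slope [- kappa (q2 0 - q1 0)]. *)
Lemma bounded_solution_costate_lt a1 q1 a2 q2 :
  bounded_solution a1 q1 -> bounded_solution a2 q2 -> q1 0 < q2 0 -> a1 0 < a2 0.
Proof.
move=> s1 s2 e; have qq := bounded_solution_order s1 s2 (ltW e).
have [[_ ca1 cq1 da1 _] [M1 aM1]] := s1; have [[_ ca2 cq2 da2 _] [M2 aM2]] := s2.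
have aa : forall t, 0 <= t -> a1 t <= a2 t.
  apply: (@adjoint_le R b kappa b_gt0 kappa_gt0 (Num.max M1 M2) a1 a2 q1 q2
    (fun t => drift b (a2 t) - kappa * q2 t)) => //.
  - by move=> t t0; exact/qq/ltW.
  - by move=> t t0; rewrite le_max (le_trans (ler_norm _) (aM1 _ t0)).
  - move=> t t0; apply: (@le_trans _ _ (- M2)); first by rewrite lerN2 le_max lexx orbT.
    by have := aM2 _ t0; rewrite ler_norml => /andP[].
rewrite lt_neqAle aa// andbT; apply/eqP => e0.
pose g t := drift b (a2 t) - kappa * q2 t - (drift b (a1 t) - kappa * q1 t).
have cdrift (a : R -> R) : C0 a -> C0 (fun t => drift b (a t)).
  by move=> ca x; apply: (@cvg_comp _ _ _ a (drift b)); [exact: ca|exact: drift_continuous].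
have cg : C0 g.
  move=> x; apply: cvgB; apply: cvgB; try exact: cdrift.
    by apply: cvgM; [exact: cvg_cst|exact: cq2].
  by apply: cvgM; [exact: cvg_cst|exact: cq1].
have [_ g0] : {in `]0, +oo[, continuous g} /\ g x @[x --> 0^'+] --> g 0.
  exact/continuous_within_itvcyP.
have gneg : g 0 < 0.
  rewrite /g e0.
  have : 0 < kappa * (q2 0 - q1 0) by rewrite mulr_gt0// subr_gt0.
  lra.
have [t /= t0 ht] : exists2 t : R, 0 < t & forall s, 0 < s < t -> g s < 0.
  have [d d0 hd] := cvgr_lt _ g0 _ gneg.
  exists d => // s /andP[s0 sd]; apply: hd => //=.
  by rewrite sub0r normrN gtr0_norm.
have t2 : 0 < t / 2 by rewrite divr_gt0.
have cd : C0 (fun t => a2 t - a1 t) by move=> x; exact: cvgB (ca2 x) (ca1 x).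
have [||c] := MVT (f := fun t => a2 t - a1 t) (df := g) t2.
- move=> x; rewrite in_itv/= => /andP[x0 _].
  by apply: is_derive_sub (da2 x x0) (da1 x x0) _.
- exact: within_sub_itv.
rewrite in_itv/= e0 => /andP[c0 ct]; rewrite subrr subr0 subr0 => ec.
have := aa (t / 2) (ltW t2); rewrite -subr_ge0 ec leNgt pmulr_llt0// ht// c0/=.
by rewrite (lt_trans ct)// ltr_pdivrMr// ltr_pMr// ltr1n.
Qed.

Lemma bounded_solution_exists_ge0 (q0 : R) : 0 <= q0 <= 1 -> exists a q,
  [/\ bounded_solution a q, q 0 = q0,
      forall t, 0 <= t -> 0 <= q t <= expR (- rate * t)
    & forall t, 0 <= t -> 0 <= a t <= kappa / b * expR (- rate * t)].
Proof.
move=> hq0.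
have [a [q [qq0 da dq qE aE]]] := pair_exists b_gt0 D_gt0 kappa_gt0 kappa_lt_bD hq0.
have E1 t : 0 <= t -> expR (- rate * t) <= 1.
  move=> t0; rewrite -expR0 ler_expR mulNr oppr_le0 mulr_ge0//.
  exact/ltW/(decay_rate_gt0 b_gt0 kappa_lt_bD).
exists a, q; split => //; split; last first.
  exists (kappa / b) => t t0; have /andP[a0 /le_trans h] := aE t t0.
  rewrite ger0_norm// h// ler_piMr ?E1//.
  by rewrite divr_ge0 ?(ltW kappa_gt0)// ltW ?b_gt0.
split.
- move=> t t0; have /andP[q0' /le_trans->] := qE t t0; last exact: E1.
  by rewrite andbT (le_trans _ q0')// lerN10.
- exact: within_of_is_derive da.
- exact: within_of_is_derive dq.
- by move=> t t0; exact/da/ltW.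
- by move=> t t0; exact/dq/ltW.
Qed.

Lemma bounded_solution_exists (q0 : R) : -1 <= q0 <= 1 -> exists a q,
  bounded_solution a q /\ q 0 = q0.
Proof.
move=> /andP[? ?]; have [q00|q00] := leP 0 q0.
  have [|a [q [s e _ _]]] := @bounded_solution_exists_ge0 q0; first exact/andP.
  by exists a, q.
have [|a [q [s e _ _]]] := @bounded_solution_exists_ge0 (- q0); first by apply/andP; split; lra.
exists (fun t => - a t), (fun t => - q t); split; first exact: bounded_solutionN.
by rewrite e opprK.
Qed.

(** The constructed solutions decay, and uniqueness makes every bounded solution
    one of them, up to the sign symmetry. *)
Lemma bounded_solution_decay a q : bounded_solution a q -> forall t, 0 <= t ->
  `|q t| <= expR (- rate * t) /\ `|a t| <= kappa / b * expR (- rate * t).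
Proof.
have gen a' q' : bounded_solution a' q' -> 0 <= q' 0 -> forall t, 0 <= t ->
    `|q' t| <= expR (- rate * t) /\ `|a' t| <= kappa / b * expR (- rate * t).
  move=> s q0 t t0; have [[/(_ 0 (lexx _))/andP[_ q1] _ _ _ _] _] := s.
  have [|a2 [q2 [s2 e hq ha]]] := @bounded_solution_exists_ge0 (q' 0); first by rewrite q0.
  rewrite (bounded_solution_unique s s2 (esym e) t0).
  rewrite (bounded_solution_costate_unique s s2 (esym e) t0).
  have /andP[? ?] := hq t t0; have /andP[? ?] := ha t t0.
  by rewrite !ger0_norm.
move=> s t t0; have [q0|/ltW q0] := leP 0 (q 0); first exact: gen.
have := gen _ _ (bounded_solutionN s); rewrite oppr_ge0 => /(_ q0 t t0).
by rewrite !normrN.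
Qed.

Lemma bounded_solution_cvg a q : bounded_solution a q ->
  (a t, q t) @[t --> +oo] --> ((0 : R), (0 : R)).
Proof.
move=> s; have rate_gt0 : 0 < rate := decay_rate_gt0 b_gt0 kappa_lt_bD.
have ha : a t @[t --> +oo] --> (0 : R).
  by apply: (decay_cvg0 rate_gt0 (C := kappa / b)) => t t0; have [] := bounded_solution_decay s t0.
have hq : q t @[t --> +oo] --> (0 : R).
  by apply: (decay_cvg0 rate_gt0 (C := 1)) => t t0; rewrite mul1r; have [] := bounded_solution_decay s t0.
exact: (cvg_pair ha hq).
Qed.

Lemma convergent_solution_bounded a q : solution beta sigma kappa a q ->
  (a t, q t) @[t --> +oo] --> ((0 : R), (0 : R)) -> bounded_solution a q.
Proof.
move=> s h; split => //; have [_ ca _ _ _] := s.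
have a0 : a t @[t --> +oo] --> (0 : R) by exact: (cvg_comp _ _ h cvg_fst).
have [T [T0 hT]] : exists T : R, 0 <= T /\ forall t, T < t -> `|a t| <= 1.
  have /cvgrPdist_le/(_ 1 ltr01)[T [_ hT]] := a0.
  exists (Num.max T 0); split; first by rewrite le_max lexx orbT.
  move=> t tT; have := hT t; rewrite sub0r normrN; apply.
  by apply: le_lt_trans tT; rewrite le_max lexx.
have [|c _ hc] := @EVT_max R (fun t => `|a t|) 0 T T0.
  by move=> x; apply: cvg_norm; exact: (within_sub_itv (lexx _) ca).
exists (Num.max `|a c| 1) => t t0; rewrite le_max; have [tT|/hT->] := leP t T; last by rewrite orbT.
by rewrite hc// in_itv/= t0.
Qed.

(** The value [n q0] is the initial costate of the bounded solution from [q0]; the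
    system being autonomous, the solution restarted at time [t] identifies the
    costate at time [t] as well.  Outside [[-1, 1]] the values of [n] are
    arbitrary. *)
Lemma stable_graph : exists n : R -> R,
  [/\ {in `[-1, 1] &, {homo n : x y / x < y}}, n 0 = 0
    & forall a q, bounded_solution a q -> forall t, 0 <= t -> a t = n (q t)].
Proof.
have hex (q0 : R) : exists p : (R -> R) * (R -> R), -1 <= q0 <= 1 ->
    bounded_solution p.1 p.2 /\ p.2 0 = q0.
  have [/bounded_solution_exists[a [q h]]|_] := boolP (-1 <= q0 <= 1); first by exists (a, q).
  by exists (id, id).
have [A hA] := choice hex.
have gr a q : bounded_solution a q -> forall t, 0 <= t -> a t = (A (q t)).1 0.
  move=> s t t0; have [[/(_ t t0) q1 _ _ _ _] _] := s.
  have [s' e] := hA _ q1.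
  have h := bounded_solution_costate_unique (bounded_solution_shift t0 s) s'.
  by rewrite -(h _ 0 (lexx _)) add0r.
exists (fun x => (A x).1 0); split => //.
- move=> x y; rewrite !in_itv/= => hx hy xy.
  have [sx ex] := hA _ hx; have [sy ey] := hA _ hy.
  by apply: (bounded_solution_costate_lt sx sy); rewrite ex ey.
- have /= <- // := gr _ _ zero_bounded_solution 0 (lexx _).
Qed.

Lemma stable_manifold_graph (n : R -> R) :
  (forall a q, bounded_solution a q -> forall t, 0 <= t -> a t = n (q t)) ->
  [set z : R * R | -1 <= z.2 <= 1 /\ z.1 = n z.2]
    = stable_manifold beta sigma kappa (0, 0).
Proof.
move=> gr; apply/seteqP; split => [[z1 z2] /= [hz ez]|[z1 z2] [a [q [s [<- <-] h]]]].
  have [a [q [s e]]] := bounded_solution_exists hz.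
  exists a, q; split; [by case: s| |exact: bounded_solution_cvg].
  by rewrite (gr _ _ s)// e -ez.
have bs := convergent_solution_bounded s h.
by split => /=; [case: s => /(_ 0 (lexx _))|exact: gr].
Qed.
End BoundedSolutions.

(** * Integration by parts for indefinite integrals *)

Section ByParts.
Context {R : realType}.
Implicit Types (f g h : R -> R) (t s x : R).
Local Notation mu := (@lebesgue_measure R).
Local Notation C0 f := {within `[(0 : R), +oo[%classic, continuous f}.

(** Both sides integrate [g s * h t] over the triangle [s <= t]; Fubini applies since
    [|g s| * |h t|] is integrable on the square. *)
Lemma fubini_triangle (T : R) g h :
  mu.-integrable `[0, T] (EFin \o g) -> mu.-integrable `[0, T] (EFin \o h) ->
  \int[mu]_(t in `[0, T]) (h t * \int[mu]_(s in `[0, t]) g s) =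
  \int[mu]_(s in `[0, T]) (g s * \int[mu]_(t in `[s, T]) h t).
Proof.
move=> ig ih.
pose G : R -> R := g \_ `[0, T]; pose H : R -> R := h \_ `[0, T].
have iG : mu.-integrable setT (EFin \o G).
  by rewrite /G -restrict_EFin; apply/integrable_restrict => //; rewrite setTI.
have iH : mu.-integrable setT (EFin \o H).
  by rewrite /H -restrict_EFin; apply/integrable_restrict => //; rewrite setTI.
have mG : measurable_fun setT G by move: (measurable_int mu iG) => /measurable_EFinP.
have mH : measurable_fun setT H by move: (measurable_int mu iH) => /measurable_EFinP.
pose F (z : R * R) := (if z.1 <= z.2 then G z.1 * H z.2 else 0).
have mF : measurable_fun setT F.
  apply: measurable_fun_ifT => //.
    by apply: measurable_fun_ler; [exact: measurable_fst|exact: measurable_snd].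
  apply: measurable_funM.
    by apply: (measurableT_comp mG); exact: measurable_fst.
  by apply: (measurableT_comp mH); exact: measurable_snd.
have mF' : measurable_fun setT (EFin \o F) by exact/measurable_EFinP.
have Fle (x y : R) : `|F (x, y)| <= `|G x| * `|H y|.
  by rewrite /F /=; case: ifP => _; rewrite ?normr0 ?mulr_ge0// normrM.
have mnG : measurable_fun setT (fun x => `|G x|%:E).
  by apply/measurable_EFinP; exact: measurableT_comp.
have mnH : measurable_fun setT (fun x => `|H x|%:E).
  by apply/measurable_EFinP; exact: measurableT_comp.
have iF : (mu \x mu)%E.-integrable setT (EFin \o F).
  apply/integrable12ltyP => //.
  have /integrableP[_ HG] := iG; have /integrableP[_ HH] := iH.
  pose K := (\int[mu]_y `|(EFin \o H) y|)%E.
  have K0 : (0 <= K)%E by exact: integral_ge0.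
  apply: (@le_lt_trans _ _ (\int[mu]_x (K * `|G x|%:E))%E); last first.
    rewrite ge0_integralZl//.
    rewrite -(fineK (_ : K \is a fin_num)) ?ge0_fin_numE//.
    by rewrite lte_mul_pinfty// ?lee_fin ?fine_ge0.
  apply: ge0_le_integral => //=.
  - by move=> x _; exact: integral_ge0.
  - have mnF : measurable_fun setT (abse \o (EFin \o F)) by exact: measurableT_comp.
    exact: (measurable_fun_fubini_tonelli_F (m2 := mu) _ mnF (fun _ => abse_ge0 _)).
  - by apply: measurable_funeM.
  - move=> x _; rewrite muleC -ge0_integralZl//=.
    apply: ge0_le_integral => //=.
    + apply: measurableT_comp => //.
      have mFx : measurable_fun setT (fun y => F (x, y)).
        by apply: (measurableT_comp mF); exact: pair1_measurable.
      exact: measurableT_comp.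
    + by apply: measurable_funeM.
    + by move=> y _; rewrite lee_fin -normrM; have := Fle x y; rewrite -normrM.
have sub_int (f : R -> R) (a b : R) : 0 <= a -> b <= T ->
    mu.-integrable `[0, T] (EFin \o f) -> mu.-integrable `[a, b] (EFin \o f).
  move=> a0 bT; apply: integrableS => //; apply: subset_itvScc => //.
have inner (f : R -> R) (a b c : R) : mu.-integrable `[a, b] (EFin \o f) ->
    (\int[mu]_x (c * (f \_ `[a, b]) x)%:E = (c * \int[mu]_(s in `[a, b]) f s)%:E)%E.
  move=> fi; under eq_integral do rewrite EFinM.
  have fi' : mu.-integrable setT (EFin \o (f \_ `[a, b])).
    by rewrite -restrict_EFin; apply/integrable_restrict => //; rewrite setTI.
  rewrite integralZl// EFinM; congr (_ * _)%E.
  rewrite [in RHS]Rintegral_mkcond /Rintegral fineK//.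
  exact: integrable_fin_num.
have E1 t : (\int[mu]_x (EFin \o F) (x, t) = (H t * \int[mu]_(s in `[0, t]) g s)%:E)%E.
  have [tT|tT] := boolP (t \in `[0, T]); last first.
    have H0 : H t = 0 by rewrite /H patchE ifF//; apply/negbTE; rewrite mem_setE.
    rewrite H0 mul0r; apply: integral0_eq => x _.
    by rewrite /F /= H0 mulr0 if_same.
  move: (tT); rewrite in_itv/= => /andP[t0 tT'].
  rewrite -inner; last by apply: sub_int ig.
  apply: eq_integral => x _; congr EFin; rewrite /F/= /G /H !patchE !mem_setE tT !in_itv/=.
  case: (leP x t) => xt; rewrite ?andbF ?andbT ?mulr0//.
  by rewrite (le_trans xt tT') andbT; case: ifP; rewrite ?mulr0 ?mul0r// mulrC.
have E2 x : (\int[mu]_y (EFin \o F) (x, y) = (G x * \int[mu]_(s in `[x, T]) h s)%:E)%E.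
  have [tT|tT] := boolP (x \in `[0, T]); last first.
    have H0 : G x = 0 by rewrite /G patchE ifF//; apply/negbTE; rewrite mem_setE.
    rewrite H0 mul0r; apply: integral0_eq => y _.
    by rewrite /F /= H0 mul0r if_same.
  move: (tT); rewrite in_itv/= => /andP[t0 tT'].
  rewrite -inner; last by apply: sub_int ih.
  apply: eq_integral => y _; congr EFin; rewrite /F/= /G /H !patchE !mem_setE tT !in_itv/=.
  case: (leP x y) => xt; rewrite ?mulr0//.
  by rewrite (le_trans t0 xt)/=; case: ifP; rewrite ?mulr0.
have := Fubini iF.
under eq_integral do rewrite E2; under [in X in _ = X -> _]eq_integral do rewrite E1.
move=> E; rewrite [LHS]Rintegral_mkcond [RHS]Rintegral_mkcond /Rintegral; congr fine.
transitivity (\int[mu]_y (H y * \int[mu]_(s in `[0, y]) g s)%:E)%E.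
  by apply: eq_integral => t _; rewrite /H !patchE; case: ifP => //; rewrite mul0r.
rewrite -E; apply: eq_integral => t _; rewrite /G !patchE; case: ifP => //; by rewrite mul0r.
Qed.

Lemma within_itv_integrable f (a b : R) :
  {within `[a, b], continuous f} -> mu.-integrable `[a, b] (EFin \o f).
Proof. by move=> cf; apply: continuous_compact_integrable => //; exact: segment_compact. Qed.

Lemma integrable_mul_continuous (a b : R) f g : a <= b ->
  mu.-integrable `[a, b] (EFin \o g) -> {within `[a, b], continuous f} ->
  mu.-integrable `[a, b] (EFin \o (fun t => g t * f t)).
Proof.
move=> ab ig cf.
have mf : measurable_fun `[a, b] f by exact: subspace_continuous_measurable_fun.
have [|c _ hc] := @EVT_max R (fun t => `|f t|) a b ab.
  by move=> x; apply: cvg_norm; exact: cf.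
have bf : [bounded f x | x in `[a, b]%classic].
  exists `|f c|; split; first exact: num_real.
  by move=> x fx y /= yab; rewrite (le_trans _ (ltW fx))// hc.
have := @integrableMl _ _ _ mu `[a, b]%classic (measurable_itv _) (EFin \o g) f ig mf bf.
by apply: eq_integrable.
Qed.

Lemma integrable_add (I : interval R) f g :
  mu.-integrable [set` I] (EFin \o f) -> mu.-integrable [set` I] (EFin \o g) ->
  mu.-integrable [set` I] (EFin \o (fun t => f t + g t)).
Proof. by move=> fi gi; apply: (@integrableD _ _ _ mu [set` I] _ (EFin \o f) (EFin \o g)). Qed.

Lemma ftc_C0 b b' (s t : R) : 0 <= s -> s <= t -> C0 b -> C0 b' ->
  (forall t, 0 < t -> is_derive t (1 : R) b (b' t)) ->
  \int[mu]_(x in `[s, t]) b' x = b t - b s.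
Proof.
move=> s0; rewrite le_eqVlt => /predU1P[<- _ _ _|st cb cb' db].
  by rewrite set_itv1 Rintegral_set1 subrr.
have cst := within_sub_itv (b := t) s0 cb.
have /(continuous_within_itvP _ st)[_ bs bt] := cst.
rewrite /Rintegral (@continuous_FTC2 R b' b s t st) ?EFinB//.
- exact: within_sub_itv.
- split => // x; rewrite in_itv/= => /andP[sx _].
  by have [] := db x (le_lt_trans s0 sx).
- move=> x; rewrite in_itv/= => /andP[sx _].
  by rewrite derive1E; have [_] := db x (le_lt_trans s0 sx).
Qed.

(** Here [m] need not be differentiable at every time, since its density [g] is only
    integrable; the identity rests on the exchange of two integrals instead of
    a product rule. *)
Lemma by_parts_indefinite (T m0 : R) g (m b b' : R -> R) : 0 <= T ->
  mu.-integrable `[0, T] (EFin \o g) ->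
  (forall t, 0 <= t <= T -> m t = m0 + \int[mu]_(s in `[0, t]) g s) ->
  C0 b -> C0 b' -> (forall t, 0 < t -> is_derive t (1 : R) b (b' t)) ->
  mu.-integrable `[0, T] (EFin \o (fun t => g t * b t + m t * b' t)) /\
  \int[mu]_(t in `[0, T]) (g t * b t + m t * b' t) = m T * b T - m0 * b 0.
Proof.
move=> T0 ig hm cb cb' db.
have cbT := within_sub_itv (b := T) (lexx 0) cb.
have cbT' := within_sub_itv (b := T) (lexx 0) cb'.
have ib' := within_itv_integrable cbT'.
pose J t := \int[mu]_(s in `[0, t]) g s.
have cJ : {within `[0, T], continuous J} by exact: parameterized_integral_continuous.
have cJb : {within `[0, T], continuous (fun t => b' t * J t)}.
  by move=> x; apply: cvgM; [exact: cbT'|exact: cJ].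
have igb : mu.-integrable `[0, T] (EFin \o (fun t => g t * b t)).
  exact: integrable_mul_continuous.
have iJb : mu.-integrable `[0, T] (EFin \o (fun t => b' t * J t)).
  exact: within_itv_integrable.
have im0 : mu.-integrable `[0, T] (EFin \o (fun t => m0 * b' t)).
  apply: within_itv_integrable => x; apply: cvgM; [exact: cvg_cst|exact: cbT'].
have imb : mu.-integrable `[0, T] (EFin \o (fun t => m0 * b' t + b' t * J t)).
  exact: integrable_add.
have mE : {in `[0, T]%classic, forall t, m0 * b' t + b' t * J t = m t * b' t}.
  by move=> t; rewrite inE/= in_itv/= => /hm->; rewrite mulrDl [b' t * _]mulrC.
have imb' : mu.-integrable `[0, T] (EFin \o (fun t => m t * b' t)).
  by apply: eq_integrable imb => // t /mE /= ->.
split.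
  exact: integrable_add.
rewrite RintegralD// -(eq_Rintegral mu mE) RintegralD// RintegralZl//.
rewrite (fubini_triangle ig ib').
rewrite (ftc_C0 (lexx _) T0 cb cb' db).
have -> : \int[mu]_(s in `[0, T]) (g s * \int[mu]_(t in `[s, T]) b' t) =
    \int[mu]_(s in `[0, T]) (g s * b T - g s * b s).
  apply: eq_Rintegral => s; rewrite inE/= in_itv/= => /andP[s0 sT].
  by rewrite (ftc_C0 s0 sT cb cb' db) mulrBr.
rewrite RintegralB//; last first.
  apply: integrable_mul_continuous => //; apply: continuous_subspaceT => x; exact: cvg_cst.
rewrite RintegralZr//.
have -> : \int[mu]_(x in `[0, T]) g x = m T - m0.
  by rewrite hm ?T0 ?lexx// addrAC subrr add0r.
ring.
Qed.
End ByParts.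

(** * The law of the chain at a fixed time *)

Section Marginals.
Context {R : realType} d (Omega : measurableType d) (P : probability Omega R).
Local Notation mu := (@lebesgue_measure R).
Implicit Types (t s : R) (x : bool).

Definition marginal (Y : R -> Omega -> bool) t : R := fine (P [set w | Y t w = true]).

Variables (rate : R -> bool -> R) (m0 : R) (Y : R -> Omega -> bool).
Hypothesis mc : markov_chain P rate m0 Y.
Hypothesis rate_int : forall x t, 0 <= t ->
  mu.-integrable `[0, t] (EFin \o (fun s => rate s x)).

Lemma measurable_state t x : 0 <= t -> measurable [set w | Y t w = x].
Proof.
move=> t0; have [mY _ _ _] := mc.
have := mY t t0 measurableT [set x] I; rewrite setTI; apply.
Qed.

Lemma marginal_itv t : 0 <= t -> 0 <= marginal Y t <= 1.
Proof.
move=> t0; have mt := measurable_state true t0.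
rewrite /marginal fine_ge0//= -lee_fin fineK ?fin_num_measure//.
exact: probability_le1.
Qed.

Lemma marginalE t : 0 <= t -> P [set w | Y t w = true] = (marginal Y t)%:E.
Proof. by move=> t0; rewrite /marginal fineK// fin_num_measure//; exact: measurable_state. Qed.

Lemma marginal_falseE t : 0 <= t -> P [set w | Y t w = false] = (1 - marginal Y t)%:E.
Proof.
move=> t0; have mt := measurable_state true t0.
rewrite (_ : [set w | Y t w = false] = ~` [set w | Y t w = true]); last first.
  by apply/seteqP; split => w /=; case: (Y t w).
by rewrite probability_setC// marginalE// EFinB.
Qed.

Lemma marginal0 : marginal Y 0 = m0.
Proof. by rewrite /marginal; have [_ _ -> _] := mc. Qed.

Lemma marginal_transition : exists2 K, transition_function rate K &
  forall t, 0 <= t -> marginal Y t = (1 - m0) * K 0 t false true + m0 * K 0 t true true.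
Proof.
have [_ _ _ [K tK hK]] := mc; exists K => // t t0.
have P0 x : P [set w | Y t w = true /\ Y 0 w = x] = (K 0 t x true * fine (P [set w | Y 0 w = x]))%:E.
  have := hK 0 t x true [::]; rewrite lexx t0 => /(_ erefl) /=.
  rewrite (_ : [set w | Y 0 w = x /\ _] = [set w | Y 0 w = x]); last first.
    by apply/seteqP; split => w /= => [[]|] //.
  move=> /(_ (fun _ => ltac:(done))) => e.
  rewrite EFinM fineK; first exact: e.
  by rewrite fin_num_measure//; exact: measurable_state.
apply: EFin_inj; rewrite -marginalE//.
rewrite (_ : [set w | Y t w = true] = [set w | Y t w = true /\ Y 0 w = false] `|`
    [set w | Y t w = true /\ Y 0 w = true]); last first.
  by apply/seteqP; split => w /=; [case: (Y 0 w); [right|left]|case=> -[]].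
have mt x : measurable [set w | Y t w = true /\ Y 0 w = x].
  by apply: (measurableI [set w | Y t w = true]); exact: measurable_state.
rewrite measureU//; last by apply/seteqP; split => w //= [[_ ->] []].
transitivity ((K 0 t false true * fine (P [set w | Y 0 w = false]))%:E +
  (K 0 t true true * fine (P [set w | Y 0 w = true]))%:E)%E.
  by congr (_ + _)%E; exact: P0.
rewrite marginal_falseE// marginalE//= marginal0 -EFinD; congr EFin; ring.
Qed.

(** Averaging over the initial law the forward equations of the transition
    probabilities from time 0 is legitimate because these are bounded by 1, so
    that the flux is as integrable as the rates. *)
Lemma marginal_forward :
  measurable_fun `[(0 : R), +oo[ (marginal Y) /\
  forall t, 0 <= t ->
    let g u := (1 - marginal Y u) * rate u false - marginal Y u * rate u true in
    mu.-integrable `[0, t] (EFin \o g) /\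
    marginal Y t = m0 + \int[mu]_(u in `[0, t]) g u.
Proof.
have [K tK mK] := marginal_transition.
pose k x u := K 0 u x false * rate u false - K 0 u x true * rate u true.
have K1 x u : 0 <= u -> K 0 u x false = 1 - K 0 u x true.
  by move=> u0; have [_ _ h _] := tK 0 x (lexx _); rewrite -(h u u0) addrK.
have Kb x y u : 0 <= u -> `|K 0 u x y| <= 1.
  move=> u0; have [_ h1 h2 _] := tK 0 x (lexx _).
  have := h2 u u0; have := h1 u false u0; have := h1 u true u0.
  by case: y => ? ? ?; rewrite ger0_norm//; lra.
split.
  apply: (@eq_measurable_fun _ _ _ _ _ (fun t => (1 - m0) * K 0 t false true + m0 * K 0 t true true)).
    by move=> t; rewrite inE/= in_itv/= andbT => /mK ->.
  apply: measurable_funD; apply: measurable_funM => //.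
    by have [/(_ true)] := tK 0 false (lexx _).
  by have [/(_ true)] := tK 0 true (lexx _).
move=> t t0 g.
have iKr x y : mu.-integrable `[0, t] (EFin \o (fun u => K 0 u x y * rate u y)).
  apply: (le_integrable _ _ _ (rate_int y t0)) => //.
  - apply/measurable_EFinP; apply: measurable_funM.
      have [/(_ y) h _ _ _] := tK 0 x (lexx _); apply: measurable_funS h => //.
      by move=> u /=; rewrite !in_itv/= => /andP[->].
    by move: (measurable_int mu (rate_int y t0)) => /measurable_EFinP.
  - move=> u /=; rewrite in_itv/= => /andP[u0 _].
    by rewrite lee_fin normrM ler_piMl// Kb.
have ik x : mu.-integrable `[0, t] (EFin \o k x).
  apply: (@integrableB _ _ _ mu `[0, t]%classic _ (EFin \o (fun u => K 0 u x false * rate u false))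
    (EFin \o (fun u => K 0 u x true * rate u true))) => //.
have ikz (c : R) x : mu.-integrable `[0, t] (EFin \o (fun u => c * k x u)).
  by apply: (@integrableZl _ _ _ mu `[0, t]%classic _ c (EFin \o k x)).
have gE : {in `[0, t]%classic, (fun u => (1 - m0) * k false u + m0 * k true u) =1 g}.
  move=> u; rewrite inE/= in_itv/= => /andP[u0 ut].
  rewrite /g /k mK// !(K1 _ _ u0); ring.
have ikk := integrable_add (ikz (1 - m0) false) (ikz m0 true).
split.
  by apply: eq_integrable ikk => // u /gE /= ->.
rewrite mK// -(eq_Rintegral mu gE) RintegralD// !RintegralZl//.
have [_ _ _ ->//] := tK 0 false (lexx _); have [_ _ _ ->//] := tK 0 true (lexx _).
rewrite /=; have -> : \int[mu]_(u in `[0, t]) (K 0 u false (~~ true) * rate u (~~ true) - K 0 u false true * rate u true) = \int[mu]_(x in `[0, t]) k false x by [].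
have -> : \int[mu]_(u in `[0, t]) (K 0 u true (~~ true) * rate u (~~ true) - K 0 u true true * rate u true) = \int[mu]_(x in `[0, t]) k true x by [].
by rewrite /=; ring.
Qed.

(** By right continuity the path is, in each state, eventually equal to its
    value at the point of the grid of step [1 / (n + 1)] just above the current
    time; this writes the set as a countable combination of rectangles. *)
Lemma measurable_state_joint :
  measurable [set z : Omega * R | 0 <= z.2 /\ Y z.2 z.1 = true].
Proof.
pose E n (k : nat) := [set w | Y (k.+1%:R / n.+1%:R) w = true] `*` `[(k%:R / n.+1%:R : R), k.+1%:R / n.+1%:R[%classic.
have mE n k : measurable (E n k).
  by apply: measurableX => //; apply: measurable_state; rewrite divr_ge0.
rewrite (_ : [set z | _] = \bigcup_N \bigcap_(n in [set n | (N <= n)%N]) \bigcup_k E n k).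
  apply: bigcupT_measurable => N; apply: bigcap_measurable; first by exists N => /=.
  by move=> n _; exact: bigcupT_measurable.
have [_ cY _ _] := mc.
pose kk n t := Num.truncn (t * n.+1%:R).
have kkP n t : 0 <= t -> (kk n t)%:R / n.+1%:R <= t < (kk n t).+1%:R / n.+1%:R.
  move=> t0; rewrite ler_pdivrMr// ltr_pdivlMr//.
  by apply: truncn_itv; rewrite mulr_ge0.
have right t w : 0 <= t -> exists N, forall n, (N <= n)%N -> Y ((kk n t).+1%:R / n.+1%:R) w = Y t w.
  move=> t0; have [hr _] := cY w t t0.
  have [e /= e0 he] := hr _ (discrete_set1 (Y t w)).
  exists (Num.truncn e^-1) => n Nn; apply: he.
    rewrite /ball_/= distrC ger0_norm ?subr_ge0; last by have /andP[_ /ltW] := kkP n t t0.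
    have /andP[h _] := kkP n t t0.
    have hn : 0 < n.+1%:R :> R by rewrite ltr0n.
    have : n.+1%:R^-1 < e.
      rewrite invf_plt// (lt_le_trans (truncnS_gt _))// ler_nat ltnS//.
    apply: le_lt_trans.
    by rewrite -[(kk n t).+1%:R]natr1 mulrDl mul1r lerBlDr [leRHS]addrC lerD2r.
  by have /andP[] := kkP n t t0.
apply/seteqP; split => [[w t] /= [t0 Yt]|[w t] /= [N _ hN]].
  have [N hN] := right t w t0.
  exists N => // n /= Nn; exists (kk n t) => //; split => /=; first by rewrite hN.
  by rewrite in_itv/=; exact: kkP.
have t0 : 0 <= t.
  have [k _ [_ /=]] := hN N (leqnn N); rewrite in_itv/= => /andP[h _].
  by apply: le_trans h; rewrite divr_ge0.
split => //; have [N' hN'] := right t w t0.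
have [k _ [/= Yk]] := hN (maxn N N') (leq_maxl _ _).
rewrite in_itv/= ler_pdivrMr// ltr_pdivlMr// => /truncn_def kE.
by rewrite -(hN' _ (leq_maxr N N')) /kk kE.
Qed.

(** Tonelli exchanges time and chance; it needs the joint measurability of the
    state. *)
Lemma cost_marginal (beta kappa : R) (p : R -> R) (alpha : R -> bool -> R) :
  0 <= kappa -> (forall t, 0 <= t -> 0 <= p t <= 1) ->
  measurable_fun `[(0 : R), +oo[ p ->
  (forall x, measurable_fun `[(0 : R), +oo[ (fun t => alpha t x)) ->
  cost P beta kappa p alpha Y =
  (\int[mu]_(t in `[0%R, +oo[) (expR (- beta * t) *
     ((1 - marginal Y t) * (2^-1 * alpha t false ^+ 2 + kappa * p t) +
      marginal Y t * (2^-1 * alpha t true ^+ 2 + kappa * (1 - p t))))%:E)%E.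
Proof.
move=> k0 p01 mp malpha.
pose c x t := expR (- beta * t) * (2^-1 * alpha t x ^+ 2 + kappa * running_cost x (p t)).
have c0 x t : 0 <= t -> 0 <= c x t.
  move=> t0; have /andP[? ?] := p01 t t0.
  apply: mulr_ge0; first exact: expR_ge0.
  apply: addr_ge0; first by apply: mulr_ge0 => //; exact: sqr_ge0.
  by apply: mulr_ge0 => //; case: x => /=; lra.
pose C x : R -> R := (c x) \_ `[0, +oo[.
have C0 x t : 0 <= C x t.
  by rewrite /C patchE; case: ifPn => //; rewrite inE/= in_itv/= andbT => /c0.
have mC x : measurable_fun setT (C x).
  rewrite /C; apply: (measurable_restrictT (D := `[(0 : R), +oo[%classic) (c x) _).1 => //.
  apply: measurable_funM.
    apply: measurable_funTS; apply: continuous_measurable_fun => y.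
    exact: is_derive_continuous (is_derive_expM _ y).
  apply: measurable_funD; apply: measurable_funM => //.
    exact: measurable_funX.
  by case: x => //=; apply: measurable_funB.
pose E := [set z : Omega * R | 0 <= z.2 /\ Y z.2 z.1 = true].
have mE : measurable E by exact: measurable_state_joint.
pose F (z : Omega * R) := (\1_E z * C true z.2 + \1_(~` E) z * C false z.2)%:E.
have F0 z : (0 <= F z)%E by rewrite lee_fin addr_ge0// mulr_ge0.
have mF : measurable_fun setT F.
  apply/measurable_EFinP; apply: measurable_funD; apply: measurable_funM.
  - by [].
  - by apply: (measurableT_comp (mC true)); exact: measurable_snd.
  - by apply: measurable_indic; exact: measurableC.
  - by apply: (measurableT_comp (mC false)); exact: measurable_snd.
rewrite /cost.
transitivity (\int[P]_w \int[mu]_t F (w, t))%E.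
  apply: eq_integral => w _; rewrite integral_mkcond; apply: eq_integral => t _.
  rewrite /F /C !patchE; case: ifPn => [|_]; last by rewrite !mulr0 addr0.
  rewrite inE/= in_itv/= andbT => t0; congr EFin.
  rewrite !indicE in_setC; have [Yt|Yt] := boolP (Y t w).
    rewrite (_ : (w, t) \in E); last by rewrite inE /E /=; split.
    by rewrite mul1r mul0r addr0.
  rewrite (_ : (w, t) \in E = false); last first.
    by apply/negbTE; rewrite notin_setE /E /= => -[_ Yt']; rewrite Yt' in Yt.
  by rewrite mul0r add0r mul1r.
transitivity (\int[mu]_t \int[P]_w F (w, t))%E.
  exact: (@fubini_tonelli _ _ _ _ _ P mu F mF F0).
rewrite [RHS]integral_mkcond.
apply: eq_integral => t _; rewrite patchE; case: ifPn; last first.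
  move=> tn; apply: integral0_eq => w _; rewrite /F /C !patchE (negbTE tn).
  by rewrite !mulr0 addr0.
rewrite inE/= in_itv/= andbT => t0.
pose A := [set w | Y t w = true].
have mA : measurable A by exact: measurable_state.
have mA' : measurable (~` A) by exact: measurableC.
transitivity (\int[P]_w ((C true t)%:E * (\1_A w)%:E + (C false t)%:E * (\1_(~` A) w)%:E))%E.
  apply: eq_integral => w _; rewrite /F -!EFinM -EFinD; congr EFin.
  rewrite [_ * C true _]mulrC [_ * C false _]mulrC !indicE !in_setC.
  have -> : ((w, t) \in E) = (w \in A).
    by apply/idP/idP; rewrite !inE /E /A /=; [case|move=> ->].
  by [].
have intA (B : set Omega) : measurable B -> measurable_fun setT (fun w => (\1_B w : R)%:E).
  by move=> mB; apply/measurable_EFinP; exact: measurable_indic.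
rewrite ge0_integralD//; last 4 first.
- by move=> w _; rewrite -EFinM lee_fin mulr_ge0.
- by apply: measurable_funeM; exact: intA.
- by move=> w _; rewrite -EFinM lee_fin mulr_ge0.
- by apply: measurable_funeM; exact: intA.
have zl (r : R) (B : set Omega) : 0 <= r -> measurable B ->
    (\int[P]_w (r%:E * (\1_B w)%:E) = r%:E * P B)%E.
  move=> r0 mB; rewrite ge0_integralZl//; first by rewrite integral_indic// setIT.
  exact: intA.
rewrite !zl// marginalE//.
rewrite (_ : ~` A = [set w | Y t w = false]); last first.
  by apply/seteqP; split => w; rewrite /A /=; case: (Y t w).
rewrite marginal_falseE// -!EFinM -EFinD; congr EFin.
have tin : t \in `[0, +oo[%classic by rewrite inE/= in_itv/= t0.
by rewrite /C !patchE tin /c /=; ring.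
Qed.
End Marginals.

(** * The cost as a constant plus a regret *)

Section IntegralAdd.
Context d {T : measurableType d} {R : realType} (mu : {measure set T -> \bar R}).

(** The identity holds in the extended reals: the two integrals are infinite
    together. *)
Lemma integral_add_integrable (A : set T) (c r D : T -> R) : measurable A ->
  measurable_fun A c -> measurable_fun A r ->
  (forall t, A t -> 0 <= c t) -> (forall t, A t -> 0 <= r t) ->
  mu.-integrable A (EFin \o D) -> (forall t, A t -> c t = r t + D t) ->
  (\int[mu]_(t in A) (c t)%:E = (\int[mu]_(t in A) D t)%:E + \int[mu]_(t in A) (r t)%:E)%E.
Proof.
move=> mA mc mr c0 r0 iD cE.
have fD : (\int[mu]_(t in A) D t)%:E = (\int[mu]_(t in A) (D t)%:E)%E.
  by rewrite /Rintegral fineK//; exact: integrable_fin_num.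
have ge0_int (f : T -> R) : measurable_fun A f -> (forall t, A t -> 0 <= f t) ->
    (\int[mu]_(t in A) (f t)%:E < +oo)%E -> mu.-integrable A (EFin \o f).
  move=> mf f0 fi; apply/integrableP; split; first exact/measurable_EFinP.
  under eq_integral.
    move=> x xA; rewrite /= ger0_norm; last by apply: f0; rewrite inE in xA.
    over.
  exact: fi.
have r_ge0 : (0 <= \int[mu]_(t in A) (r t)%:E)%E.
  by apply: integral_ge0 => x Ax; rewrite lee_fin r0.
have c_ge0 : (0 <= \int[mu]_(t in A) (c t)%:E)%E.
  by apply: integral_ge0 => x Ax; rewrite lee_fin c0.
have [ri|ri] := ltP (\int[mu]_(t in A) (r t)%:E)%E +oo%E.
  have ir := ge0_int r mr r0 ri.
  rewrite fD -(integralD mA iD ir); apply: eq_integral => x; rewrite inE => Ax.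
  by rewrite cE//= -EFinD addrC.
move: (ri); rewrite leye_eq => /eqP ->; rewrite addey//.
apply/eqP; rewrite -leye_eq leNgt; apply/negP => ci.
have ic := ge0_int c mc c0 ci.
have ir : mu.-integrable A (EFin \o r).
  have := integrableB mA ic iD; apply: eq_integrable => // x; rewrite inE => Ax.
  by rewrite /= cE// -EFinB [r x + _]addrC addrAC subrr add0r.
by have := integrable_lty mA ir; rewrite ltNge ri.
Qed.

End IntegralAdd.

Section Verification.
Context {R : realType}.
Implicit Types (f g h : R -> R) (t s : R) (x : bool).
Local Notation mu := (@lebesgue_measure R).
Local Notation C0 f := {within `[(0 : R), +oo[%classic, continuous f}.

Lemma half_line_bigcup : `[(0 : R), +oo[%classic = \bigcup_n `[(0 : R), n%:R]%classic.
Proof.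
apply/seteqP; split => [x|x [n _]] /=; rewrite !in_itv/= ?andbT; last by case/andP.
move=> x0; exists (Num.truncn x).+1 => //=.
by rewrite in_itv/= x0 ltW// truncnS_gt.
Qed.

Lemma measurable_half_line f :
  (forall t, 0 <= t -> measurable_fun `[0, t] f) -> measurable_fun `[(0 : R), +oo[ f.
Proof.
move=> mf; rewrite half_line_bigcup; apply/measurable_fun_bigcup => // n.
exact: mf.
Qed.

Lemma half_line_cvg_integral f : measurable_fun `[(0 : R), +oo[ f ->
  (forall t, 0 <= t -> 0 <= f t) ->
  (\int[mu]_(t in `[0%R, n%:R]) (f t)%:E @[n --> \oo] -->
   \int[mu]_(t in `[0%R, +oo[) (f t)%:E)%E.
Proof.
move=> mf f0; rewrite half_line_bigcup.
apply: ge0_nondecreasing_set_cvg_integral => //.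
- move=> m n mn; rewrite subsetEset => x /=; rewrite !in_itv/= => /andP[-> xm].
  by rewrite (le_trans xm)// ler_nat.
- move=> n; apply/measurable_EFinP; apply: measurable_funS mf => //.
  by move=> x /=; rewrite !in_itv/= => /andP[->].
- by move=> n x /=; rewrite in_itv/= => /andP[x0 _]; rewrite lee_fin f0.
Qed.

Variables (beta sigma kappa : R).
Hypotheses (beta_gt0 : 0 < beta) (kappa_gt0 : 0 < kappa).
Let b := beta + 2 * sigma ^+ 2.

(** Data of the control problem for a given flow [q], with the costate [a] and
    the marginal [m] of the chain driven by the control [alpha]. *)
Variables (a q m : R -> R) (m0 M : R) (alpha : R -> bool -> R).
Hypotheses (q1 : forall t, 0 <= t -> -1 <= q t <= 1) (cq : C0 q) (ca : C0 a).
Hypothesis da : forall t, 0 < t -> is_derive t (1 : R) a (drift b (a t) - kappa * q t).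
Hypothesis aM : forall t, 0 <= t -> `|a t| <= M.
Let p t := (q t + 1) / 2.
Let flux (f0 f1 : R -> R) t := (1 - m t) * (sigma ^+ 2 + f0 t) - m t * (sigma ^+ 2 + f1 t).
Let g := flux (alpha^~ false) (alpha^~ true).
Hypothesis m01 : forall t, 0 <= t -> 0 <= m t <= 1.
Hypothesis mm : measurable_fun `[(0 : R), +oo[ m.
Hypothesis adm : admissible alpha.
Hypothesis m_int : forall t, 0 <= t -> mu.-integrable `[0, t] (EFin \o g) /\
  m t = m0 + \int[mu]_(u in `[0, t]) g u.

(** The minimizer of the Hamiltonian, [a t] being the value in state 0 minus the
    value in state 1. *)
Definition feedback (x : bool) t := if x then Num.max (- a t) 0 else Num.max (a t) 0.

Let c t := expR (- beta * t) *
  ((1 - m t) * (2^-1 * alpha t false ^+ 2 + kappa * p t) +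
   m t * (2^-1 * alpha t true ^+ 2 + kappa * (1 - p t))).

(** The discounted mean excess of the Hamiltonian over its minimum: with [A] and [B]
    the positive and negative parts of [a], one has
    [x ^ 2 / 2 - a x = ((x - A) ^ 2 + 2 x B) / 2 - A ^ 2 / 2]. *)
Definition regret t := expR (- beta * t) * (2^-1 *
  ((1 - m t) * ((alpha t false - feedback false t) ^+ 2 + 2 * alpha t false * feedback true t) +
   m t * ((alpha t true - feedback true t) ^+ 2 + 2 * alpha t true * feedback false t))).

Lemma feedback_ge0 x t : 0 <= feedback x t.
Proof. by case: x; rewrite /feedback le_max lexx orbT. Qed.

Lemma feedback_cont x : C0 (feedback x).
Proof.
have cm : continuous (fun y : R => Num.max y 0).
  by move=> y; apply: continuous_max; [exact: cvg_id|exact: cvg_cst].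
have cna : C0 (fun t => - a t) by move=> y; apply: cvgN; exact: ca.
case: x => y.
  by apply: (@cvg_comp _ _ _ (fun t => - a t) (fun y => Num.max y 0)); [exact: cna|exact: cm].
by apply: (@cvg_comp _ _ _ a (fun y => Num.max y 0)); [exact: ca|exact: cm].
Qed.

Lemma regret_ge0 t : 0 <= t -> 0 <= regret t.
Proof.
move=> t0; have /andP[? ?] := m01 t0.
have a0 : 0 <= alpha t false by have [h _] := adm false; exact: h.
have a1 : 0 <= alpha t true by have [h _] := adm true; exact: h.
have f0 := feedback_ge0 false t; have f1 := feedback_ge0 true t.
apply: mulr_ge0; first exact: expR_ge0.
apply: mulr_ge0 => //; apply: addr_ge0; apply: mulr_ge0; try lra.
  by apply: addr_ge0; [exact: sqr_ge0|rewrite -mulrA; apply: mulr_ge0 => //; exact: mulr_ge0].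
by apply: addr_ge0; [exact: sqr_ge0|rewrite -mulrA; apply: mulr_ge0 => //; exact: mulr_ge0].
Qed.

Lemma measurable_control x : measurable_fun `[(0 : R), +oo[ (alpha^~ x).
Proof.
apply: measurable_half_line => t t0; have [_ /(_ t t0) h] := adm x.
by move: (measurable_int mu h) => /measurable_EFinP.
Qed.

Lemma measurable_C0 f : C0 f -> measurable_fun `[(0 : R), +oo[ f.
Proof. by move=> cf; exact: subspace_continuous_measurable_fun. Qed.

Let e t := expR (- beta * t).

Lemma discount_cont : C0 e.
Proof.
apply: within_continuous_of_continuous => y.
exact: is_derive_continuous (is_derive_expM _ y).
Qed.

Lemma measurable_regret : measurable_fun `[(0 : R), +oo[ regret.
Proof.
have mf x := measurable_C0 (@feedback_cont x).
have ma := measurable_control.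
apply: measurable_funM; first exact: measurable_C0 discount_cont.
apply: measurable_funM => //; apply: measurable_funD; apply: measurable_funM => //.
- by apply: measurable_funB.
- apply: measurable_funD; first by apply: measurable_funX; exact: measurable_funB.
  by apply: measurable_funM => //; exact: measurable_funM.
- apply: measurable_funD; first by apply: measurable_funX; exact: measurable_funB.
  by apply: measurable_funM => //; exact: measurable_funM.
Qed.

Lemma measurable_mass : measurable_fun `[(0 : R), +oo[ p.
Proof.
apply: measurable_funM => //; apply: measurable_funD => //; exact: measurable_C0.
Qed.

Lemma measurable_expected_cost : measurable_fun `[(0 : R), +oo[ c.
Proof.
have ma := measurable_control.
apply: measurable_funM; first exact: measurable_C0 discount_cont.
apply: measurable_funD; apply: measurable_funM => //.
- exact: measurable_funB.
- apply: measurable_funD; apply: measurable_funM => //; first exact: measurable_funX.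
  exact: measurable_mass.
- apply: measurable_funD; apply: measurable_funM => //; first exact: measurable_funX.
  by apply: measurable_funB => //; exact: measurable_mass.
Qed.

Lemma mass_itv t : 0 <= t -> 0 <= p t <= 1.
Proof. by move=> t0; have /andP[? ?] := q1 t0; rewrite /p; apply/andP; split; lra. Qed.

Lemma expected_cost_ge0 t : 0 <= t -> 0 <= c t.
Proof.
move=> t0; have /andP[? ?] := m01 t0; have /andP[? ?] := mass_itv t0.
apply: mulr_ge0; first exact: expR_ge0.
apply: addr_ge0; apply: mulr_ge0; try lra.
  apply: addr_ge0; apply: mulr_ge0 => //; [exact: sqr_ge0|exact: ltW].
apply: addr_ge0; apply: mulr_ge0 => //; [exact: sqr_ge0|exact: ltW|lra].
Qed.

(** The source of the Hamilton-Jacobi-Bellman equation [v' = beta v - k] in state 0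
    once the value difference [a] is known. *)
Let k t := kappa * p t - sigma ^+ 2 * a t - 2^-1 * feedback false t ^+ 2.
Let db t := e t * (- beta * a t + (drift b (a t) - kappa * q t)).

Lemma cost_decomposition t : 0 <= t -> c t = regret t + (e t * k t + (g t * (e t * a t) + m t * db t)).
Proof.
move=> t0; rewrite /c /regret /k /db /g /flux driftE /p /b -/(e t).
have [[[-> ->] ->]|[[-> ->] ->]] :
   (feedback false t = 0 /\ feedback true t = - a t) /\ `|a t| = - a t \/
    (feedback false t = a t /\ feedback true t = 0) /\ `|a t| = a t.
- rewrite /feedback; have [a0|/ltW a0] := leP (a t) 0; [left|right].
    split; last exact: ler0_norm.
    by split => //; apply: max_l; rewrite oppr_ge0.
  split; last exact: ger0_norm.
  by split => //; apply: max_r; rewrite oppr_le0.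
- move: (alpha t false) (alpha t true) (m t) (e t) (a t) (q t) => A0 A1 mt et at' qt.
  by field.
- move: (alpha t false) (alpha t true) (m t) (e t) (a t) (q t) => A0 A1 mt et at' qt.
  by field.
Qed.

Lemma within_cst (x : R) : C0 (fun=> x).
Proof. exact: within_continuous_of_continuous (fun y => cvg_cst x). Qed.

Lemma mass_cont : C0 p.
Proof.
by move=> x; apply: cvgM; [apply: cvgD; [exact: cq|exact: within_cst]|exact: within_cst].
Qed.

Lemma state0_cost_cont : C0 k.
Proof.
move=> x; apply: cvgB; first apply: cvgB.
- by apply: cvgM; [exact: within_cst|exact: mass_cont].
- by apply: cvgM; [exact: within_cst|exact: ca].
- apply: cvgM; first exact: within_cst.
  apply: (@cvg_comp _ _ _ (feedback false) (fun y : R => y ^+ 2)).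
    exact: (@feedback_cont false).
  exact: exprn_continuous.
Qed.

Lemma discounted_costate_cont : C0 db.
Proof.
move=> x; apply: cvgM; first exact: discount_cont.
apply: cvgD; first by apply: cvgM; [exact: within_cst|exact: ca].
apply: cvgB; last by apply: cvgM; [exact: within_cst|exact: cq].
by apply: (@cvg_comp _ _ _ a (drift b)); [exact: ca|exact: drift_continuous].
Qed.

Lemma state0_value_exists : exists v : R -> R, exists N : R,
  (forall t, 0 <= t -> is_derive t (1 : R) v (beta * v t - k t)) /\
  (forall t, 0 <= t -> `|v t| <= N).
Proof.
pose C := kappa + sigma ^+ 2 * M + 2^-1 * (M * M).
have [|t t0|v [dv vC]] := @backward_linear R beta C (fun t => k (Num.max t 0)) beta_gt0.
- exact: continuous_clamp state0_cost_cont.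
- rewrite max_l// /k.
  have /andP[? ?] := mass_itv t0; have ? := aM t0.
  have M0 : 0 <= M by apply: le_trans (aM t0).
  have kp : `|kappa * p t| <= kappa.
    have k0 := ltW kappa_gt0.
    by rewrite ger0_norm; [exact: ler_piMr|exact: mulr_ge0].
  have sa : `|sigma ^+ 2 * a t| <= sigma ^+ 2 * M.
    by rewrite normrM (ger0_norm (sqr_ge0 _)) ler_wpM2l ?sqr_ge0.
  have ff : `|2^-1 * feedback false t ^+ 2| <= 2^-1 * (M * M).
    rewrite ger0_norm; last by apply: mulr_ge0 => //; exact: sqr_ge0.
    apply: ler_wpM2l => //.
    have f0 := feedback_ge0 false t.
    have fM : feedback false t <= M.
      by rewrite /feedback ge_max M0 (le_trans (ler_norm _)).
    by rewrite expr2 ler_pM.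
  rewrite (le_trans (ler_normB _ _))// lerD// (le_trans (ler_normB _ _))// lerD//.
- exists v, (C / beta); split => // t t0.
  by have := dv t t0; rewrite max_l.
Qed.

(** Integrating [cost_decomposition] over [[0, n]], the part other than the regret is
    the increment of [exp (- beta t) (m t * a t - v t)], whose value at time [n] tends to
    0 because [a], [m] and [v] are bounded.  The constant does not depend on the
    control. *)
Lemma cost_identity (v : R -> R) (N : R) :
  (forall t, 0 <= t -> is_derive t (1 : R) v (beta * v t - k t)) ->
  (forall t, 0 <= t -> `|v t| <= N) ->
  (\int[mu]_(t in `[0%R, +oo[) (c t)%:E =
   (v 0 - m0 * a 0)%:E + \int[mu]_(t in `[0%R, +oo[) (regret t)%:E)%E.
Proof.
move=> dv vN.
pose D t := e t * k t + (g t * (e t * a t) + m t * db t).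
pose h (T : R) := v 0 - e T * v T + (m T * (e T * a T) - m0 * a 0).
have cv := within_of_is_derive dv.
have cek : C0 (fun t => e t * k t).
  by move=> x; apply: cvgM; [exact: discount_cont|exact: state0_cost_cont].
have cea : C0 (fun t => e t * a t).
  by move=> x; apply: cvgM; [exact: discount_cont|exact: ca].
have e0 : e 0 = 1 by rewrite /e mulr0 expR0.
have finite_horizon (T : R) : 0 <= T ->
    mu.-integrable `[0, T] (EFin \o D) /\ \int[mu]_(t in `[0, T]) D t = h T.
  move=> T0; have [ig _] := m_int T0.
  have hm t : 0 <= t <= T -> m t = m0 + \int[mu]_(s in `[0, t]) g s.
    by move=> /andP[/m_int[]].
  have dea t : 0 < t -> is_derive t (1 : R) (fun t => e t * a t) (db t).
    move=> t0; apply: is_derive_mul (is_derive_expM (- beta) t) (da t0) _.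
    by rewrite /db /e; ring.
  have [iD1 ID1] := by_parts_indefinite T0 ig hm cea discounted_costate_cont dea.
  have iek := within_itv_integrable (within_sub_itv (b := T) (lexx 0) cek).
  split; first exact: integrable_add.
  rewrite RintegralD// ID1 e0 mul1r; congr (_ + _).
  have cev : C0 (fun t => - (e t * v t)).
    by move=> x; apply: cvgN; apply: cvgM; [exact: discount_cont|exact: cv].
  have dev t : 0 < t -> is_derive t (1 : R) (fun t => - (e t * v t)) (e t * k t).
    move=> t0; apply: is_derive_opp (is_derive_mul (is_derive_expM (- beta) t) (dv t (ltW t0)) erefl) _.
    by rewrite /e; ring.
  by rewrite (ftc_C0 (lexx 0) T0 cev cek dev) e0 mul1r opprK addrC.
have IT (T : R) : 0 <= T ->
    (\int[mu]_(t in `[0%R, T]) (c t)%:E = (h T)%:E + \int[mu]_(t in `[0%R, T]) (regret t)%:E)%E.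
  move=> T0; have [iD ID] := finite_horizon T T0; rewrite -ID.
  have sub : `[0, T]%classic `<=` `[(0 : R), +oo[%classic.
    by move=> x /=; rewrite !in_itv/= => /andP[->].
  apply: integral_add_integrable => //.
  - exact: measurable_funS sub measurable_expected_cost.
  - exact: measurable_funS sub measurable_regret.
  - by move=> t /=; rewrite in_itv/= => /andP[/expected_cost_ge0].
  - by move=> t /=; rewrite in_itv/= => /andP[/regret_ge0].
  - by move=> t /=; rewrite in_itv/= => /andP[/cost_decomposition].
have ch : h n%:R @[n --> \oo] --> v 0 - m0 * a 0.
  have -> : (fun n : nat => h n%:R) =
      (fun n : nat => v 0 - m0 * a 0 + (e n%:R * (m n%:R * a n%:R - v n%:R))).
    by apply/funext => n; rewrite /h; ring.
  rewrite -[X in _ --> X]addr0; apply: cvgD; first exact: cvg_cst.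
  have lim : e t * (m t * a t - v t) @[t --> +oo] --> (0 : R).
    apply: (@decay_cvg0 R beta (M + N) _ beta_gt0) => t t0.
    rewrite normrM (ger0_norm (expR_ge0 _)) mulrC; apply: ler_wpM2r; first exact: expR_ge0.
    rewrite (le_trans (ler_normB _ _))// lerD ?vN//.
    have /andP[? ?] := m01 t0.
    by rewrite normrM ger0_norm// (le_trans _ (aM t0))// ler_piMl.
  by apply: (cvg_comp _ _ _ lim); exact: cvgr_idn.
have L1 := half_line_cvg_integral measurable_expected_cost expected_cost_ge0.
have L2 := half_line_cvg_integral measurable_regret regret_ge0.
have L3 : ((h n%:R)%:E + \int[mu]_(t in `[0%R, n%:R]) (regret t)%:E @[n --> \oo] -->
   (v 0 - m0 * a 0)%:E + \int[mu]_(t in `[0%R, +oo[) (regret t)%:E)%E.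
  apply: cvgeD => //; last by apply: cvg_EFin; [exact: nearW|exact: ch].
apply: (cvg_unique _ L1) => //.
rewrite (_ : (fun n : nat => _) = (fun n : nat => (h n%:R)%:E + \int[mu]_(t in `[0%R, n%:R]) (regret t)%:E)%E);
  last by apply/funext => n; rewrite IT ?ler0n.
exact: L3.
Qed.

(** If the regret vanishes at a time, the control agrees with the feedback in each
    state of positive probability, and a state of probability 0 does not
    contribute to the flux. *)
Lemma flux_feedback : (\int[mu]_(t in `[0%R, +oo[) (regret t)%:E = 0)%E ->
  forall t, 0 <= t -> m t = m0 + \int[mu]_(u in `[0, t])
    ((1 - m u) * (sigma ^+ 2 + feedback false u) - m u * (sigma ^+ 2 + feedback true u)).
Proof.
move=> r0 t t0; have [ig ->] := m_int t0; congr (_ + _).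
have mr := measurable_regret.
have aer : ae_eq mu [set` `[(0 : R), +oo[] (EFin \o regret) (cst 0%E).
  apply/ae_eq_integral_abs => //; first exact/measurable_EFinP.
  rewrite -[RHS]r0; apply: eq_integral => s; rewrite inE/= in_itv/= andbT => s0.
  by rewrite ger0_norm ?regret_ge0.
have flux0 s : 0 <= s -> regret s = 0 ->
    g s = (1 - m s) * (sigma ^+ 2 + feedback false s) - m s * (sigma ^+ 2 + feedback true s).
  move=> s0; have /andP[m0' m1'] := m01 s0.
  have a0 : 0 <= alpha s false by have [h _] := adm false; exact: h.
  have a1 : 0 <= alpha s true by have [h _] := adm true; exact: h.
  have f0 := feedback_ge0 false s; have f1 := feedback_ge0 true s.
  rewrite /regret /g /flux; set X := (_ - m s) * _; set Y := m s * _.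
  have X0 : 0 <= (1 - m s) * (alpha s false - feedback false s) ^+ 2.
    by apply: mulr_ge0; [lra|exact: sqr_ge0].
  have Y0 : 0 <= m s * (alpha s true - feedback true s) ^+ 2.
    by apply: mulr_ge0; [lra|exact: sqr_ge0].
  have X1 : 0 <= (1 - m s) * (alpha s false * feedback true s).
    by apply: mulr_ge0; [lra|exact: mulr_ge0].
  have Y1 : 0 <= m s * (alpha s true * feedback false s).
    by apply: mulr_ge0; [lra|exact: mulr_ge0].
  move=> /eqP; rewrite mulf_eq0 gt_eqF ?expR_gt0//= mulf_eq0 invr_eq0 pnatr_eq0/= => /eqP XY.
  have XE : (1 - m s) * (alpha s false - feedback false s) ^+ 2 = 0.
    by move: XY; rewrite /X /Y; lra.
  have YE : m s * (alpha s true - feedback true s) ^+ 2 = 0.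
    by move: XY; rewrite /X /Y; lra.
  have zero (x y : R) : x * y ^+ 2 = 0 -> x * y = 0.
    by move/eqP; rewrite mulf_eq0 sqrf_eq0 => /orP[] /eqP ->; rewrite ?mul0r ?mulr0.
  rewrite -[Num.max (a s) 0]/(feedback false s) -[Num.max (- a s) 0]/(feedback true s).
  by have := zero _ _ XE; have := zero _ _ YE; lra.
rewrite /Rintegral; congr fine; apply: ae_eq_integral => //.
- by move: (measurable_int mu ig).
- have sub : `[0, t]%classic `<=` `[(0 : R), +oo[%classic.
    by move=> x /=; rewrite !in_itv/= => /andP[->].
  apply/measurable_EFinP; apply: (measurable_funS _ sub) => //.
  have mf x := measurable_C0 (@feedback_cont x).
  by apply: measurable_funB; apply: measurable_funM => //; [exact: measurable_funB| |];
    exact: measurable_funD.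
- apply: filterS aer => s h; rewrite /= in_itv/= => /andP[s0 st].
  by rewrite flux0//; have := h; rewrite /= in_itv/= s0 => /(_ isT) [].
Qed.
End Verification.

(** * Nash equilibria and bounded solutions *)

Section IndefiniteIntegral.
Context {R : realType}.
Implicit Types s t : R.
Local Notation mu := (@lebesgue_measure R).
Local Notation C0 f := {within `[(0 : R), +oo[%classic, continuous f}.
Variables (m0 : R) (g m : R -> R).
Hypothesis m_int : forall t, 0 <= t -> mu.-integrable `[0, t] (EFin \o g) /\
  m t = m0 + \int[mu]_(u in `[0, t]) g u.

Lemma indefinite_integral_cont : C0 m.
Proof.
have mT (T : R) : 0 < T -> {within `[0, T], continuous m}.
  move=> T0; have [ig _] := m_int (ltW T0).
  have cI : {within `[0, T], continuous (fun x => m0 + \int[mu]_(u in `[0, x]) g u)}.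
    have := parameterized_integral_continuous (ltW T0) ig => cI x.
    by apply: cvgD; [exact: cvg_cst|exact: cI].
  apply: (subspace_eq_continuous _ cI) => x.
  by rewrite inE/= in_itv/= => /andP[x0 _]; have [_ /esym] := m_int x0.
apply/continuous_within_itvcyP; split => [x|].
  rewrite in_itv/= andbT => x0; have x1 : 0 < x + 1 by lra.
  have /(continuous_within_itvP _ x1)[h _ _] := mT _ x1.
  by apply: h; rewrite in_itv/= x0/=; lra.
by have /(continuous_within_itvP _ ltr01)[] := mT 1 ltr01.
Qed.

Lemma indefinite_integral_deriv (t : R) : C0 g -> 0 < t -> is_derive t (1 : R) m (g t).
Proof.
move=> cg t0; have [F dF] := antiderivative (continuous_clamp cg).
have dF' (s : R) : 0 <= s -> is_derive s (1 : R) F (g s) by move=> s0; rewrite -{2}(max_l s0); exact: dF.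
apply: (@near_eq_is_derive _ _ _ (fun s => (m0 - F 0) + F s)).
  near=> s; have s0 : 0 <= s by apply/ltW; near: s; exact: lt_nbhsr.
  have [_ ->] := m_int s0.
  by rewrite (ftc_C0 (lexx 0) s0 (within_of_is_derive dF') cg (fun u h => dF' u (ltW h))); ring.
rewrite -[g t]add0r; apply: is_derive_add (is_derive_cst _ _ _) (dF' t (ltW t0)) erefl.
Unshelve. all: by end_near. Qed.

End IndefiniteIntegral.

Section Equilibria.
Context {R : realType}.
Implicit Types s t : R.
Local Notation mu := (@lebesgue_measure R).
Local Notation C0 f := {within `[(0 : R), +oo[%classic, continuous f}.
Variables (beta sigma kappa : R).
Hypotheses (beta_gt0 : 0 < beta) (kappa_gt0 : 0 < kappa).
Let b := beta + 2 * sigma ^+ 2.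

Let b_gt0 : 0 < b.
Proof. by rewrite /b ltr_wpDr// mulr_ge0// sqr_ge0. Qed.

Lemma feedback_prod0 (a : R -> R) t : feedback a false t * feedback a true t = 0.
Proof.
rewrite /feedback; have [a0|a0] := leP (a t) 0; first by rewrite mul0r.
by rewrite max_r ?mulr0// oppr_le0 ltW.
Qed.

Lemma feedback_admissible (a : R -> R) : C0 a -> admissible (fun t x => feedback a x t).
Proof.
move=> ca x; split => t t0; first exact: feedback_ge0.
exact: within_itv_integrable (within_sub_itv (b := t) (lexx 0) (feedback_cont ca (x := x))).
Qed.

Lemma feedback_regret (a m : R -> R) t : regret beta a m (fun t x => feedback a x t) t = 0.
Proof.
have e := feedback_prod0 a t.
rewrite /regret !subrr -[2 * _ * _]mulrA e -[2 * feedback a true t * _]mulrA.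
by rewrite [feedback a true t * _]mulrC e !mulr0 expr0n/= addr0 !mulr0 addr0 !mulr0.
Qed.

Definition feedback_flux (a m : R -> R) t :=
  (1 - m t) * (sigma ^+ 2 + feedback a false t) - m t * (sigma ^+ 2 + feedback a true t).

(** In the variable [2 m - 1] the feedback flux is the second component of the
    dynamical system. *)
Lemma feedback_fluxE (a m : R -> R) t :
  2 * feedback_flux a m t = a t - (2 * sigma ^+ 2 + `|a t|) * (2 * m t - 1).
Proof.
rewrite /feedback_flux /feedback; have [a0|a0] := leP (a t) 0.
  by rewrite ler0_norm// max_l ?oppr_ge0//; ring.
by rewrite gtr0_norm// max_r ?oppr_le0 ?ltW//; ring.
Qed.

Lemma feedback_flux_cont (a m : R -> R) : C0 a -> C0 m -> C0 (feedback_flux a m).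
Proof.
move=> ca cm; have cf x := feedback_cont ca (x := x).
move=> x; apply: cvgB; apply: cvgM.
- by apply: cvgB; [exact: cvg_cst|exact: cm].
- by apply: cvgD; [exact: cvg_cst|exact: cf].
- exact: cm.
- by apply: cvgD; [exact: cvg_cst|exact: cf].
Qed.

Context d (Omega : measurableType d) (P : probability Omega R).
Variable X : R -> (R -> bool -> R) -> R -> Omega -> bool.
Hypothesis cX : controlled_chains P sigma X.

Lemma controlled_marginal (m0 : R) alpha : 0 <= m0 <= 1 -> admissible alpha ->
  let m := marginal P (X m0 alpha) in
  [/\ forall t, 0 <= t -> 0 <= m t <= 1, measurable_fun `[(0 : R), +oo[ m &
      forall t, 0 <= t ->
        mu.-integrable `[0, t] (EFin \o (fun t => (1 - m t) * (sigma ^+ 2 + alpha t false)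
                                         - m t * (sigma ^+ 2 + alpha t true))) /\
        m t = m0 + \int[mu]_(u in `[0, t]) ((1 - m u) * (sigma ^+ 2 + alpha u false)
                                         - m u * (sigma ^+ 2 + alpha u true))].
Proof.
move=> m01 adm m; have mc := cX m01 adm.
have [|mm mi] := marginal_forward mc.
  move=> x t t0; have [_ /(_ t t0) ia] := adm x.
  have ic : mu.-integrable `[0, t] (EFin \o (cst (sigma ^+ 2) : R -> R)).
    by apply: within_itv_integrable => y; exact: cvg_cst.
  exact: (integrable_add ic ia).
by split => //; exact: marginal_itv mc.
Qed.

Lemma cost_regret (a q : R -> R) (M : R) :
  (forall t, 0 <= t -> -1 <= q t <= 1) -> C0 q -> C0 a ->
  (forall t, 0 < t -> is_derive t (1 : R) a (drift b (a t) - kappa * q t)) ->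
  (forall t, 0 <= t -> `|a t| <= M) ->
  exists v0 : R, forall m0 alpha, 0 <= m0 <= 1 -> admissible alpha ->
    (cost P beta kappa (fun t => (q t + 1) / 2)%R alpha (X m0 alpha) =
     (v0 - m0 * a 0)%:E + \int[mu]_(t in `[0%R, +oo[)
                             (regret beta a (marginal P (X m0 alpha)) alpha t)%:E)%E.
Proof.
move=> q1 cq ca da aM.
have [v [N [dv vN]]] := state0_value_exists sigma beta_gt0 kappa_gt0 q1 cq ca aM.
exists (v 0) => m0 alpha m01 adm.
have [mi mm m_int] := controlled_marginal m01 adm.
rewrite (cost_marginal (cX m01 adm)) ?ltW//.
- have h := cost_identity beta_gt0 kappa_gt0 q1 cq ca da aM mi mm adm m_int dv vN.
  exact: h.
- exact: mass_itv.
- exact: measurable_mass.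
- exact: measurable_control.
Qed.

(** The feedback built from the bounded costate of [q] is an admissible competitor
    with zero regret, so the optimal control has zero regret too, and its chain
    follows the feedback flux. *)
Lemma nash_bounded_solution (q : R -> R) : nash_equilibrium_q P beta kappa X q ->
  exists a, bounded_solution beta sigma kappa a q.
Proof.
move=> [p01 [al [adm opt pE]]].
set m0 := (q 0 + 1) / 2 in opt pE *.
have m01 : 0 <= m0 <= 1 by exact: p01.
have [mi mm m_int] := controlled_marginal m01 adm.
set m := marginal _ _ in mi mm m_int.
have qm (t : R) : 0 <= t -> q t = 2 * m t - 1.
  move=> t0; have := pE t t0; rewrite (marginalE (cX m01 adm))// => -[]; rewrite -/m => <-.
  by field.
have cm := indefinite_integral_cont m_int.
have q1 (t : R) : 0 <= t -> -1 <= q t <= 1.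
  by move=> t0; rewrite qm//; have /andP[? ?] := mi t t0; apply/andP; split; lra.
have cq : C0 q.
  apply: (@subspace_eq_continuous _ _ _ (fun t => 2 * m t - 1)).
    by move=> x; rewrite inE/= in_itv/= andbT => x0; exact/esym/qm.
  by move=> x; apply: cvgB; [apply: cvgM; [exact: cvg_cst|exact: cm]|exact: cvg_cst].
have [|a [da aM]] := adjoint_exists b_gt0 kappa_gt0 (continuous_clamp cq).
  move=> t t0; rewrite max_l//; have /andP[? ?] := q1 t t0; rewrite ler_norml; exact/andP.
have {}da (t : R) : 0 <= t -> is_derive t (1 : R) a (drift b (a t) - kappa * q t).
  by move=> t0; rewrite -{3}(max_l t0); exact: da.
have ca := within_of_is_derive da.
have [v0 cE] := cost_regret q1 cq ca (fun t h => da t (ltW h)) aM.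
have fadm := feedback_admissible ca.
have r0 : (\int[mu]_(t in `[0%R, +oo[) (regret beta a m al t)%:E = 0)%E.
  have := opt _ fadm; rewrite !cE//.
  under [X in (_ <= _ + X)%E]eq_integral do rewrite feedback_regret.
  rewrite integral0 leeD2lE// => le0; apply/eqP; rewrite eq_le le0/=.
  apply: integral_ge0 => t /=; rewrite in_itv/= andbT lee_fin => t0.
  exact: regret_ge0.
have flux := flux_feedback ca mi mm adm m_int r0.
have cg := feedback_flux_cont ca cm.
have mg_int (t : R) : 0 <= t -> mu.-integrable `[0, t] (EFin \o feedback_flux a m) /\
    m t = m0 + \int[mu]_(u in `[0, t]) feedback_flux a m u.
  move=> t0; split; last exact: flux.
  exact: within_itv_integrable (within_sub_itv (b := t) (lexx 0) cg).
exists a; split; last by exists (kappa / b).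
split => // t t0.
  exact: da t (ltW t0).
apply: (@near_eq_is_derive _ _ _ (fun t => 2 * m t + - 1)).
  by near=> s; rewrite qm//; apply/ltW; near: s; exact: lt_nbhsr.
apply: is_derive_add (is_derive_scale _ (indefinite_integral_deriv mg_int cg t0)) (is_derive_cst _ _ _) _.
by rewrite qm ?(ltW t0)// addr0 feedback_fluxE.
Unshelve. all: by end_near. Qed.

(** The feedback is optimal because it has zero regret.  The law of its chain and [q]
    solve the same linear equation with the same initial value; their
    difference is damped at rate [2 sigma ^ 2 + |a|]. *)
Lemma bounded_solution_nash (a q : R -> R) : bounded_solution beta sigma kappa a q ->
  nash_equilibrium_q P beta kappa X q.
Proof.
move=> [[q1 ca cq da dq] [M aM]].
have {}da (t : R) : 0 < t -> is_derive t (1 : R) a (drift b (a t) - kappa * q t).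
  exact: da.
have [v0 cE] := cost_regret q1 cq ca da aM.
have fadm := feedback_admissible ca.
have p01 (t : R) : 0 <= t -> 0 <= (q t + 1) / 2 <= 1 by exact: mass_itv.
split => //; exists (fun t x => feedback a x t).
set m0 := (q 0 + 1) / 2; have m01 : 0 <= m0 <= 1 by exact: p01.
have [mi mm m_int] := controlled_marginal m01 fadm.
split => //.
  move=> al adm; rewrite !cE//.
  under [X in (_ + X <= _)%E]eq_integral do rewrite feedback_regret.
  have [mi' _ _] := controlled_marginal m01 adm.
  rewrite integral0 leeD2lE//; apply: integral_ge0 => t /=; rewrite in_itv/= andbT lee_fin => t0.
  exact: regret_ge0.
move=> t t0; rewrite (marginalE (cX m01 fadm))//; congr (_%:E).
set m := marginal _ _ in mi mm m_int *.
have cm := indefinite_integral_cont m_int.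
have cg := feedback_flux_cont ca cm.
have dm (s : R) : 0 < s -> is_derive s (1 : R) m (feedback_flux a m s) by move=> s0; apply: (indefinite_integral_deriv m_int).
pose dl s := q s + - (2 * m s - 1).
have cdl : C0 dl.
  move=> x; apply: cvgD; first exact: cq.
  by apply: cvgN; apply: cvgB; [apply: cvgM; [exact: cvg_cst|exact: cm]|exact: cvg_cst].
have ddl (s : R) : 0 < s -> is_derive s (1 : R) dl (- (2 * sigma ^+ 2 + `|a s|) * dl s).
  move=> s0.
  have d2m : is_derive s (1 : R) (fun s => 2 * m s + - 1) (2 * feedback_flux a m s).
    apply: is_derive_add (is_derive_scale _ (dm s s0)) (is_derive_cst _ _ _) _.
    by rewrite addr0.
  apply: is_derive_add (dq s s0) (is_derive_opp d2m erefl) _.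
  by rewrite /dl feedback_fluxE; ring.
have rate_ge0 (s : R) : 0 <= 2 * sigma ^+ 2 + `|a s| by rewrite addr_ge0// mulr_ge0// sqr_ge0.
have dl0 : dl 0 = 0 by rewrite /dl /m (marginal0 (cX m01 fadm)) /m0; field.
have dl_ge0 : 0 <= dl t.
  apply: (forward_ge0 cdl ddl) => // [s s0 sl|]; last by rewrite dl0.
  by rewrite mulNr oppr_ge0; apply: mulr_ge0_le0 => //; exact: ltW.
have dl_le0 : 0 <= - dl t.
  apply: (@forward_ge0 _ (fun s => - dl s) (fun s => - (- (2 * sigma ^+ 2 + `|a s|) * dl s))) => //.
  - by move=> x; apply: cvgN; exact: cdl.
  - by move=> s s0; exact: is_derive_opp (ddl s s0) erefl.
  - by move=> s s0; rewrite oppr_lt0 => sl; rewrite mulNr opprK; apply: mulr_ge0 => //; exact: ltW.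
  - by rewrite dl0 oppr0.
have : dl t = 0 by lra.
by rewrite /dl; lra.
Qed.

End Equilibria.

Unset Implicit Arguments.
Theorem proposition6p2 (R : realType) (beta sigma kappa : R)
    (beta_gt0 : 0 < beta) (sigma_gt0 : 0 < sigma) (kappa_gt0 : 0 < kappa)
    (kappa_lt : kappa < 2 * beta * sigma ^+ 2 + 4 * sigma ^+ 4) :
  exists n : R -> R,
    [/\ {in `[-1, 1] &, {homo n : x y / x < y}},
        n 0 = 0,
        [set z : R * R | -1 <= z.2 <= 1 /\ z.1 = n z.2]
          = stable_manifold beta sigma kappa (0, 0)
      & forall (d : measure_display) (Omega : measurableType d)
          (P : probability Omega R)
          (X : R -> (R -> bool -> R) -> R -> Omega -> bool),
          controlled_chains P sigma X ->
          [/\ forall q : R -> R, nash_equilibrium_q P beta kappa X q ->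
                exists a : R -> R,
                  solution beta sigma kappa a q /\
                  (forall t, 0 <= t -> a t = n (q t)),
              forall q0 : R, -1 <= q0 <= 1 ->
                (exists q : R -> R,
                   nash_equilibrium_q P beta kappa X q /\ q 0 = q0) /\
                (forall q1 q2 : R -> R,
                   nash_equilibrium_q P beta kappa X q1 -> q1 0 = q0 ->
                   nash_equilibrium_q P beta kappa X q2 -> q2 0 = q0 ->
                   forall t, 0 <= t -> q1 t = q2 t)
            & forall q : R -> R, nash_equilibrium_q P beta kappa X q ->
                (n (q t), q t) @[t --> +oo] --> ((0 : R), (0 : R))]].
Proof.
have [n [n_incr n0 nE]] := stable_graph beta_gt0 sigma_gt0 kappa_gt0 kappa_lt.
exists n; split => //; first exact: stable_manifold_graph nE.
move=> d Omega P X cX.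
have nash_graph q : nash_equilibrium_q P beta kappa X q ->
    exists2 a, bounded_solution beta sigma kappa a q & forall t, 0 <= t -> a t = n (q t).
  move=> /(nash_bounded_solution beta_gt0 kappa_gt0 cX)[a aq].
  by exists a => // t t0; exact: nE aq t t0.
split.
- by move=> q /nash_graph[a [aq _] an]; exists a.
- move=> q0 q01; split.
    have [a [q [aq <-]]] := bounded_solution_exists beta_gt0 sigma_gt0 kappa_gt0 kappa_lt q01.
    by exists q; split => //; exact: (bounded_solution_nash beta_gt0 kappa_gt0 cX aq).
  move=> q1 q2 /nash_graph[a1 aq1 _] e1 /nash_graph[a2 aq2 _] e2.
  by apply: bounded_solution_unique aq1 aq2 _ => //; rewrite e1.
- move=> q /nash_graph[a aq an].
  apply: cvg_trans (bounded_solution_cvg beta_gt0 sigma_gt0 kappa_gt0 kappa_lt aq).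
  apply: near_eq_cvg; near=> t; rewrite an//; near: t; exact: nbhs_pinfty_ge.
Unshelve. all: by end_near. Qed.
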